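(* With $Y$, $T^c$, $T^j$ as defined in the context (depending on $\varepsilon$), for any $\varepsilon\in(0,1)$ the process $e^{Y}$ has the no arbitrage property with respect to $\Pi(\mathbb F^{Y,T^c,T^j})$.
   Context: Setting. Let $B^c,B^j,W^c,W^j$ be independent Brownian motions on a probability space $(\Omega,\mathcal F,\mathbb P)$ and let $X^j$ be a pure jump Lévy process, independent of $(B^c,B^j,W^c)$ (of the form $X^j_t=a^j_1J_t+a^j_2W^j_{J_t}$ with $J$ a non-decreasing pure jump Lévy process). Let $$Y_t:=X^c_{T^c_t}+X^j_{T^j_t},$$ where $$X^c_t=a^c_1t+a^c_2B^c_t+a^c_3B^j_t+a^c_4W^c_t,$$ $$dv^c_t=\mu^c(1-\varepsilon-v^c_t)dt+\sigma^c\sqrt{v^c_t(1-\rho^2)}\,dB^c_t+\rho\sigma^c\sqrt{v^c_t}\,dB^j_t,$$ $$dv^j_t=\mu^j(1-v^j_t)dt+\sigma^j\sqrt{v^j_t}\,dB^j_t,$$ $$T^c_t=\int_0^t(v^c_s+\varepsilon)ds,\qquad T^j_t=\int_0^tv^j_sds,$$ for given constants $\rho\in[-1,1]$, $\varepsilon>0$ and $a^x_i,\mu^x,\sigma^x$ ($x\in\{c,j\}$, $i=1,2,\dots$) with $a^c_4\neq0$; $v^c,v^j$ are nonnegative and start from deterministic values. $\mathbb F^{Y,T^c,T^j}$ is the augmented filtration generated by $(Y,T^c,T^j)$. Trading strategies. For a filtration $\mathbb H=(\mathcal H_t)_{t\ge0}$, $\mathcal S(\mathbb H)$ is the set of processes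 $H=g_0\mathbf 1_{\{0\}}+\sum_{j=1}^{n-1}g_j\mathbf 1_{(\tau_j,\tau_{j+1}]}$ with $n\ge2$, $0\le\tau_1\le\dots\le\tau_n$ $\mathbb H$-stopping times, $\tau_n$ bounded, $g_0$ a real number, and $g_j$ an $\mathcal H_{\tau_j}$-measurable random variable. For $h>0$, $\mathcal S^h(\mathbb H)$ is the subset of those with $\min_j(\tau_{j+1}-\tau_j)\ge h$ a.s., and $\Pi(\mathbb H):=\bigcup_{h>0}\mathcal S^h(\mathbb H)$ (the Cheridito class). For such $H$ and an $\mathbb H$-adapted process $S$, $(H\cdot S)_\infty:=\sum_{j=1}^{n-1}g_j(S_{\tau_{j+1}}-S_{\tau_j})$. No arbitrage. An $\mathbb H$-adapted process $S$ has the no arbitrage property with respect to a class $\mathcal X$ of such strategies if $\{(H\cdot S)_\infty:H\in\mathcal X\}\cap L_0^+=\{0\}$, where $L_0^+$ is the set of nonnegative $\mathcal F$-measurable random variables. *)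

(* Defs.v *)
From HB Require Import structures.
From mathcomp Require Import all_boot all_order all_algebra.
From mathcomp Require Import all_classical all_reals all_analysis.
Set Implicit Arguments.
Unset Strict Implicit.
Unset Printing Implicit Defensive.
Import Order.TTheory GRing.Theory Num.Theory.
Import numFieldNormedType.Exports.
Local Open Scope classical_set_scope.
Local Open Scope ring_scope.

(* A process is a function X : R -> T -> R of which only the times t >= 0
   matter.  The probability space is not assumed to be complete: path
   properties hold almost surely, i.e. the complement is P.-negligible. *)

Section Filtrations.
Context d (T : measurableType d) (R : realType) (P : probability T R).

Definition past (X : R -> T -> R) (t : R) : set (set T) :=
  [set A | exists s (B : set R),
    [/\ 0 <= s <= t, measurable B & A = X s @^-1` B]].

Definition history (X : R -> T -> R) : set (set T) :=
  [set A | exists2 t, 0 <= t & past X t A].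

(* The usual augmentation, P-null sets and right-continuity, of the filtration
   t |-> <<s G t >>. *)
Definition augmented (G : R -> set (set T)) (t : R) : set (set T) :=
  [set A | forall u, t < u -> <<s G u `|` P.-negligible >> A].

Definition wrt (F : set (set T)) (f : T -> R) : Prop :=
  forall B : set R, measurable B -> F (f @^-1` B).

Definition adapted (F : R -> set (set T)) (X : R -> T -> R) : Prop :=
  forall t, 0 <= t -> wrt (F t) (X t).

Definition stopping_time (F : R -> set (set T)) (tau : T -> R) : Prop :=
  (forall w, 0 <= tau w) /\
  forall t, 0 <= t -> F t [set w | tau w <= t].

(* For a finite stopping time bounded by some constant N, A = A `&` {tau <= N},
   so that membership of A in F N need not be required separately. *)
Definition stopped (F : R -> set (set T)) (tau : T -> R) : set (set T) :=
  [set A | forall t, 0 <= t -> F t (A `&` [set w | tau w <= t])].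

Definition independent (F G : set (set T)) : Prop :=
  forall A B, F A -> G B -> P (A `&` B) = (P A * P B)%E.

Definition mutually_independent (I : finType) (F : I -> set (set T)) : Prop :=
  forall (K : {set I}) (E : I -> set T), (forall i, i \in K -> F i (E i)) ->
  P (\bigcap_(i in [set` K]) E i) = (\prod_(i in K) P (E i))%E.

End Filtrations.

Section Processes.
Context d (T : measurableType d) (R : realType) (P : probability T R).
Implicit Types X B J v : R -> T -> R.

Definition is_process X : Prop :=
  forall t, 0 <= t -> measurable_fun setT (X t).

Definition continuous_paths X : Prop :=
  (\forall w \ae P, {within `[0, +oo[, continuous (X ^~ w)}).

Definition cadlag_paths X : Prop :=
  (\forall w \ae P,
    (forall t, 0 <= t -> X s w @[s --> t^'+] --> X t w) /\
    (forall t, 0 < t -> cvg (X s w @[s --> t^'-]))).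

Definition independent_increments X : Prop :=
  forall s t, 0 <= s -> s < t ->
  forall (A : set T) (B : set R), <<s past X s >> A -> measurable B ->
  P (A `&` (X t \- X s)%R @^-1` B) = (P A * P ((X t \- X s)%R @^-1` B))%E.

Definition brownian_motion B : Prop :=
  [/\ is_process B,
      (\forall w \ae P, B 0 w = 0),
      continuous_paths B,
      independent_increments B &
      forall s t, 0 <= s -> s < t -> forall A : set R, measurable A ->
        P ((B t \- B s) @^-1` A) = normal_prob 0 (Num.sqrt (t - s)) A].

Definition levy_process X : Prop :=
  [/\ is_process X,
      (\forall w \ae P, X 0 w = 0),
      cadlag_paths X,
      independent_increments X &
      forall s t, 0 <= s -> 0 <= t -> forall A : set R, measurable A ->
        P ((X (s + t) \- X s) @^-1` A) = P (X t @^-1` A)].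

(* No Gaussian component: the real and imaginary parts of
   E exp(i u X_t) = exp (t psi(u)),
   psi(u) = i b u + int (exp(i u x) - 1 - i u x 1_{|x| <= 1}) nu(dx). *)
Definition pure_jump X : Prop :=
  exists (b : R) (nu : {measure set (measurableTypeR R) -> \bar R}),
  [/\ nu [set 0] = 0%E,
      (\int[nu]_x (Num.min 1 (x ^+ 2))%:E < +oo)%E &
      forall t u, 0 <= t ->
        let re := \int[nu]_x (cos (u * x) - 1) in
        let im := u * b +
          \int[nu]_x (sin (u * x) - u * x * \1_(`[-1, 1] : set R) x) in
        \int[P]_w cos (u * X t w) = expR (t * re) * cos (t * im) /\
        \int[P]_w sin (u * X t w) = expR (t * re) * sin (t * im)].

(* For a nondecreasing process started at 0, pure jump means that it is the sum
   of its jumps: in particular it has no drift. *)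
Definition nondecreasing_pure_jump J : Prop :=
  (\forall w \ae P,
    (forall s t, 0 <= s -> s <= t -> J s w <= J t w) /\
    (forall t, 0 <= t ->
      \esum_(s in [set` `]0, t]]) (J s w - lim (J r w @[r --> s^'-]))%:E
      = (J t w)%:E)).

End Processes.

(* The data n, g_0, (tau_j), (g_j) of the process
   H = g_0 1_{0} + \sum_(1 <= j < n) g_j 1_(tau_j, tau_(j+1)]. *)
Record strategy (T : Type) (R : realType) := Strategy {
  ndates : nat;
  pos0 : R;
  date : nat -> T -> R;
  pos : nat -> T -> R }.

Section Strategies.
Context d (T : measurableType d) (R : realType) (P : probability T R).
Implicit Types (F : R -> set (set T)) (H : strategy T R) (X S : R -> T -> R).

Definition position H (t : R) (w : T) : R :=
  (if t == 0 then pos0 H else 0) +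
  \sum_(1 <= j < ndates H | date H j w < t <= date H j.+1 w) pos H j w.

Definition simple F H : Prop :=
  [/\ (2 <= ndates H)%N,
      forall j, (1 <= j <= ndates H)%N -> stopping_time F (date H j),
      forall j w, (1 <= j < ndates H)%N -> date H j w <= date H j.+1 w,
      (exists C, forall w, date H (ndates H) w <= C) &
      forall j, (1 <= j < ndates H)%N ->
        wrt (stopped F (date H j)) (pos H j)].

Definition simple_gap F (h : R) H : Prop :=
  simple F H /\
  (\forall w \ae P, forall j, (1 <= j < ndates H)%N ->
    h <= date H j.+1 w - date H j w).

Definition cheridito F : set (strategy T R) :=
  \bigcup_(h in [set h : R | 0 < h]) [set H | simple_gap F h H].

Definition gain H S (w : T) : R :=
  \sum_(1 <= j < ndates H)
    pos H j w * (S (date H j.+1 w) w - S (date H j w) w).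

Definition gain_upto H X (t : R) (w : T) : R :=
  \sum_(1 <= j < ndates H) pos H j w *
    (X (Num.min (date H j.+1 w) t) w - X (Num.min (date H j w) t) w).

(* Equality with {0} is between sets of almost sure equivalence classes, each
   being represented by the set of its measurable members. *)
Definition no_arbitrage F (K : set (strategy T R)) S : Prop :=
  adapted F S /\
  [set f : T -> R | measurable_fun setT f /\
     exists2 H, K H & (\forall w \ae P, f w = gain H S w)] `&`
  [set f : T -> R | measurable_fun setT f /\ (\forall w \ae P, 0 <= f w)] =
  [set f : T -> R | measurable_fun setT f /\ (\forall w \ae P, f w = 0)].

(* mu_ext P is the outer probability, so that no measurability is implied. *)
Definition cvg_in_probability (Z : nat -> T -> \bar R) : Prop :=
  forall e : R, 0 < e ->
  mu_ext P [set w | (e%:E <= `|Z n w|)%E] @[n --> \oo] --> 0%E.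

(* I is the Ito integral process of H against the F-Brownian motion B. *)
Definition ito_integral F (B H I : R -> T -> R) : Prop :=
  continuous_paths P I /\
  exists Hn : nat -> strategy T R,
  (forall n, simple F (Hn n)) /\
  forall t, 0 <= t ->
    cvg_in_probability (fun n w =>
      (\int[lebesgue_measure]_(s in `[0%R, t])
        ((position (Hn n) s w - H s w) ^+ 2)%R%:E)%E) /\
    cvg_in_probability (fun n w =>
      (gain_upto (Hn n) B t w - I t w)%:E).

(* Strong solution of
   dv = b(v) dt + s1(v) dB1 + s2(v) dB2,   v_0 deterministic. *)
Definition strong_solution (B1 B2 : R -> T -> R) (b s1 s2 : R -> R) (v0 : R)
    (v : R -> T -> R) : Prop :=
  let F := augmented P (fun t => past B1 t `|` past B2 t) in
  [/\ adapted F v, continuous_paths P v &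
      exists I1 I2 : R -> T -> R,
      [/\ ito_integral F B1 (fun t w => s1 (v t w)) I1,
          ito_integral F B2 (fun t w => s2 (v t w)) I2 &
          (\forall w \ae P, forall t, 0 <= t ->
            v t w = v0 + \int[lebesgue_measure]_(s in `[0, t]) b (v s w)
                    + I1 t w + I2 t w)]].

End Strategies.

Definition clock (T : Type) (R : realType) (r : R -> T -> R) (t : R) (w : T)
  : R := \int[lebesgue_measure]_(s in `[0, t]) r s w.

(* Main.v *)
(* The asset price is S = exp Y with Y_t = a path determined by (Bc, Bj, Xj) at
   time t, plus ac4 W(Tc_t), where W = Wc is a Brownian motion independent of
   (Bc, Bj, Xj) and the clock Tc, a functional of (Bc, Bj), grows at rate at
   least eps.  Hence, from any date u on, W may drag Y below (or above) every
   value taken before u, and keep it there during a whole interval [v, C] with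
   u < v: on a set where Tc_u <= a and the paths of Bc, Bj, Xj and of W up to a
   are bounded by a constant, it suffices that W_r - W_a be very negative for
   all r >= a + eta in a compact interval, where eta is eps (v - u) / 2; this
   event has positive probability and is independent of the path of W up to a
   and of (Bc, Bj, Xj).  So no set of positive probability known at time u
   avoids this "crossing" event.

   This rules out arbitrage when trades are at least h apart.  Let V_k be the
   gain of the first k - 1 trades, and assume V_(k+1) >= 0 almost surely.  On
   the set {V_k <= 0, g_k > 0}, cut along {s - h/4 < tau_k <= s}, a crossing
   with u = s + h/4 and v = u + h/2 makes V_(k+1) negative; so this set is
   negligible, and likewise with g_k < 0.  Thus g_k = 0 wherever V_k <= 0, so
   that V_k >= 0 almost surely; by induction V_k = 0, and V_(k+1) = 0. *)
Require Import Defs.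
From HB Require Import structures.
From mathcomp Require Import all_boot all_order all_algebra.
From mathcomp Require Import all_classical all_reals all_analysis.
From mathcomp Require Import measurable_realfun lra ring.
Import Order.TTheory GRing.Theory Num.Theory.
Import numFieldNormedType.Exports.
Local Open Scope classical_set_scope.
Local Open Scope ring_scope.

Set Implicit Arguments.
Unset Strict Implicit.
Unset Printing Implicit Defensive.

(** * Independence and null sets *)

Section IndependenceAndNullSets.
Context d (T : measurableType d) (R : realType) (P : probability T R).
Implicit Types (A D : set T) (C G : set (set T)).

Definition independent_of D := [set A | measurable A /\ P (A `&` D) = (P A * P D)%E].

Lemma lambda_system_independent_of D :
  measurable D -> lambda_system setT (independent_of D).
Proof.
move=> mD; split => //.
- by split => //; rewrite setTI probability_setT mul1e.
- move=> A B BA [mA iA] [mB iB]; split; first exact: measurableD.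
  have -> : (A `\` B) `&` D = (A `&` D) `\` (B `&` D).
    by apply/seteqP; split => x /=; tauto.
  have fin E : measurable E -> P E \is a fin_num by exact: fin_num_measure.
  have mAD := measurableI _ _ mA mD; have mBD := measurableI _ _ mB mD.
  have PD E F : measurable E -> measurable F -> F `<=` E ->
      P (E `\` F) = (P E - P F)%E.
    move=> mE mF FE; rewrite -[in RHS](setIidr FE).
    by apply: measureD => //; rewrite ltey_eq fin.
  rewrite !PD //; last exact: setSI.
  rewrite iA iB muleBl ?fin //.
  by rewrite fin_num_adde_defl// fin_numN fin.
- move=> F ndF FH; have mF n : measurable (F n) by have [] := FH n.
  split; first exact: bigcupT_measurable.
  have ndFD : nondecreasing_seq (fun n => F n `&` D).
    by move=> m n mn; apply/subsetPset; apply: setSI; apply/subsetPset/ndF.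
  have c1 : P (F n `&` D) @[n --> \oo] --> P (\bigcup_n F n `&` D).
    rewrite setI_bigcupl; apply: nondecreasing_cvg_mu => //.
      by move=> n; exact: measurableI.
    by apply: bigcup_measurable => n _; exact: measurableI.
  have c2 : (P (F n) * P D)%E @[n --> \oo] --> (P (\bigcup_n F n) * P D)%E.
    apply: cvgeZr; first exact: fin_num_measure.
    by apply: nondecreasing_cvg_mu => //; exact: bigcupT_measurable.
  apply: cvg_unique c1 _ => //; apply: cvg_trans c2.
  by apply: near_eq_cvg; near=> n; have [_ ->] := FH n.
Unshelve. all: by end_near. Qed.

(** Dynkin's pi-lambda theorem: it lets independence be checked on a pi-system of generators. *)
Lemma independent_of_generated C D :
  setI_closed C -> measurable D -> C `<=` independent_of D ->
  <<s C >> `<=` independent_of D.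
Proof.
move=> CI mD CD; apply: lambda_system_subset => //.
exact: lambda_system_independent_of.
Qed.

Lemma independent_of_bigcap (F : (set T)^nat) D :
  measurable D -> nonincreasing_seq F -> (forall n, independent_of D (F n)) ->
  independent_of D (\bigcap_n F n).
Proof.
move=> mD niF FD.
have [iT] := lambda_system_independent_of mD.
move=> DT HD nd; rewrite -[X in independent_of _ X]setCK setC_bigcap -setTD.
apply: (HD) => //; apply: nd => [m n mn|n].
  by apply/subsetPset/subsetC/subsetPset/niF.
by rewrite -setTD; apply: HD.
Qed.

(** The sets that differ by a null set from a member of [<<s G >>] form a sigma-algebra containing
    [G] and all null sets. *)
Lemma completion_approx G A : <<s G `|` P.-negligible >> A ->
  exists2 A0, <<s G >> A0 & P.-negligible ((A `\` A0) `|` (A0 `\` A)).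
Proof.
pose H := [set A | exists2 A0, <<s G >> A0 &
  P.-negligible ((A `\` A0) `|` (A0 `\` A))].
suff : <<s G `|` P.-negligible >> `<=` H by apply.
apply: smallest_sub; last first.
  move=> B [GB|NB].
    exists B; first exact: sub_sigma_algebra.
    by rewrite setDv setU0; exact: negligible_set0.
  exists set0; first exact: sigma_algebra0.
  by rewrite setD0 set0D setU0.
split.
- exists set0; first exact: sigma_algebra0.
  by rewrite setDv setU0; exact: negligible_set0.
- move=> B [B0 GB0 NB0]; exists (setT `\` B0); first exact: sigma_algebraCD.
  apply: negligibleS NB0 => x /=.
  by have [Bx|Bx] := pselect (B x); have [B0x|B0x] := pselect (B0 x); tauto.
- move=> F FH; have /choice[F0 F0P] : forall n, exists A0, <<s G >> A0 /\
      P.-negligible ((F n `\` A0) `|` (A0 `\` F n)).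
    by move=> n; have [A0 ? ?] := FH n; exists A0.
  exists (\bigcup_n F0 n).
    by apply: sigma_algebra_bigcup => n; have [] := F0P n.
  apply: (@negligibleS _ _ _ _ (\bigcup_n ((F n `\` F0 n) `|` (F0 n `\` F n)))).
    move=> x [[[n _ Fx] nF0]|[[n _ Fx] nF0]]; exists n => //.
      by left; split => // Fnx; apply: nF0; exists n.
    by right; split => // Fnx; apply: nF0; exists n.
  by apply: negligible_bigcup => n; have [] := F0P n.
Qed.

(** Up to a null set [A] is some [A0] in [<<s G >>], and P A0 * P D = P (A0 D) = 0 forces P A0 = 0.
    Applied with [D] a Brownian excursion, it plays the part of a positive conditional
    probability. *)
Lemma negligible_of_independent G A D :
  measurable D -> P D != 0%E -> <<s G >> `<=` independent_of D ->
  <<s G `|` P.-negligible >> A -> P.-negligible (A `&` D) -> P.-negligible A.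
Proof.
move=> mD PD GD /completion_approx[A0 GA0 NA] NAD.
have [mA0 PA0D] := GD _ GA0.
have : P.-negligible (A0 `&` D).
  apply: negligibleS (negligibleU NAD NA) => x /= [A0x Dx].
  by have [Ax|Ax] := pselect (A x); [left|right; right].
move=> /(measure_negligible (measurableI _ _ mA0 mD)) PA0D0.
have /eqP : P (A0 `&` D) = 0%E by [].
rewrite PA0D.
rewrite mule_eq0 => /orP[/eqP PA0|/eqP PD0]; last by rewrite PD0 eqxx in PD.
have NA0 : P.-negligible A0 by exists A0; split.
apply: negligibleS (negligibleU NA0 NA) => x /= Ax.
by have [A0x|A0x] := pselect (A0 x); [left|right; left].
Qed.

End IndependenceAndNullSets.

(** * Increments of Brownian motion *)

Section GeneratedFunctions.
Context d (T : measurableType d) (R : realType).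
Implicit Types (X : R -> T -> R) (G : set (set T)) (f : T -> R).

(** Gives access to the closure properties of [measurable_fun] for a generated sigma-algebra on
    [T]. *)
Lemma wrtP G f :
  wrt <<s G >> f <-> measurable_fun setT (f : g_sigma_algebraType G -> R).
Proof.
split=> [wf _ B mB|mf B mB]; first by rewrite setTI; exact: wf.
by rewrite -[_ @^-1` _]setTI; exact: mf.
Qed.

Lemma wrt_sub G1 G2 f : <<s G1 >> `<=` <<s G2 >> ->
  wrt <<s G1 >> f -> wrt <<s G2 >> f.
Proof. by move=> G12 wf B mB; apply: G12; exact: wf. Qed.

Lemma sub_past X s t : s <= t -> past X s `<=` past X t.
Proof.
move=> st A [r [B [/andP[r0 rs] mB ->]]]; exists r, B; split => //.
by rewrite r0 (le_trans rs).
Qed.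

Lemma past_history X t : 0 <= t -> past X t `<=` history X.
Proof. by move=> t0 A pA; exists t. Qed.

Lemma wrt_past X s t : 0 <= s <= t -> wrt <<s past X t >> (X s).
Proof. by move=> st B mB; apply: sub_sigma_algebra; exists s, B. Qed.

Lemma history_measurable X : is_process X -> <<s history X >> `<=` measurable.
Proof.
move=> mX; apply: smallest_sub; first exact: sigma_algebra_measurable.
move=> _ [t t0 [s [B [/andP[s0 _] mB ->]]]].
by rewrite -[_ @^-1` _]setTI; exact: mX.
Qed.

End GeneratedFunctions.

(** * Dyadic grid events and independent increments *)

Section BrownianGrid.
Context d (T : measurableType d) (R : realType) (P : probability T R).
Implicit Types (X : R -> T -> R) (A : set T).

(** Each level constrains finitely many times, so the event is measurable for any process; for
    right-continuous paths the intersection over [n] bounds the path on [0, L). *)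
Definition grid_bounded X (M : R) (L n : nat) : set T :=
  [set w | forall i, (i <= L * 2 ^ n)%N -> `|X (i%:R / 2 ^+ n) w| <= M].

Lemma grid_bounded_measurable (G : set (set T)) X M L n :
  (forall i, (i <= L * 2 ^ n)%N -> wrt <<s G >> (X (i%:R / 2 ^+ n))) ->
  <<s G >> (grid_bounded X M L n).
Proof.
move=> wX.
suff : measurable (grid_bounded X M L n : set (g_sigma_algebraType G)) by [].
have -> : grid_bounded X M L n = \bigcap_(i in [set i | (i <= L * 2 ^ n)%N])
    (X (i%:R / 2 ^+ n) @^-1` `[- M, M]).
  by apply/seteqP; split => w Hw i /Hw /=; rewrite in_itv/= ler_norml.
apply: bigcap_measurable; first by exists 0%N.
by move=> i /= iL; apply: (wX i iL).
Qed.

(** The point i / 2^n of level n is the point of index 2 i of level n + 1. *)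
Lemma grid_bounded_nonincreasing X M L :
  nonincreasing_seq (grid_bounded X M L).
Proof.
apply/nonincreasing_seqP => n; apply/subsetPset => w Hw i iL.
have := Hw (i * 2)%N; rewrite expnS mulnA [(L * 2)%N]mulnC -mulnA (mulnC 2 _).
rewrite leq_mul2r iL orbT => /(_ isT).
by rewrite natrM exprS invfM mulrA mulfK// pnatr_eq0.
Qed.

Variable W : R -> T -> R.
Hypotheses (mW : is_process W) (iW : independent_increments P W).
Variables (q : R) (n : nat).
Hypothesis q0 : 0 <= q.

Let time i : R := q + i%:R / 2 ^+ n.
Let incr i : T -> R := W (time i.+1) \- W (time i).
Let rect m (B : nat -> set R) := [set w | forall i, (i < m)%N -> B i (incr i w)].

Let time_ge i : q <= time i.
Proof. by rewrite lerDl divr_ge0// exprn_ge0. Qed.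

Let timeS i : time i < time i.+1.
Proof. by rewrite ltrD2l ltr_pM2r ?ltr_nat// invr_gt0 exprn_gt0. Qed.

Let wrt_incr i : wrt <<s past W (time i.+1) >> (incr i).
Proof.
apply: (wrtP _ _).2; apply: measurable_funB; apply: (wrtP _ _).1; apply: wrt_past.
  by rewrite lexx (le_trans q0).
by rewrite (le_trans q0 (time_ge i)) ltW.
Qed.

Let rectS m B : rect m.+1 B = rect m B `&` incr m @^-1` B m.
Proof.
apply/seteqP; split => w /=.
  by move=> H; split => [i im|]; apply: H => //; rewrite ltnS ltnW.
by move=> [H Hm] i; rewrite ltnS leq_eqVlt => /orP[/eqP->//|/H].
Qed.

(** Induction on the number of increments, splitting off the last one. The first conjunct places the
    event in the past of [time m], as the next use of [iW] demands. *)
Let rect_indep m B A : (forall i, measurable (B i)) -> <<s past W q >> A ->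
  <<s past W (time m) >> (A `&` rect m B) /\
  P (A `&` rect m B) = (P A * \prod_(i < m) P (incr i @^-1` B i))%E.
Proof.
move=> mB; elim: m A => [|m IH] A GA.
  have -> : rect 0 B = setT by apply/seteqP; split.
  rewrite setIT big_ord0 mule1; split => //.
  by apply: sub_sigma_algebra2 GA; apply: sub_past.
have [GAm PAm] := IH A GA.
rewrite rectS setIA; split.
  suff : measurable (A `&` rect m B `&` incr m @^-1` B m :
      set (g_sigma_algebraType (past W (time m.+1)))) by [].
  apply: measurableI.
    by apply: sub_sigma_algebra2 GAm; apply: sub_past; exact: ltW.
  exact: wrt_incr.
rewrite big_ord_recr/= muleA -PAm; apply: iW => //.
by rewrite (le_trans q0).
Qed.

Let sW A : <<s past W q >> A -> measurable A.
Proof.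
move=> GA; apply: (history_measurable mW).
by apply: sub_sigma_algebra2 GA; exact: past_history.
Qed.

(** The rectangles of increments after [q] form a pi-system independent of [A], and the grid values
    of W (q + t) - W q are measurable for the sigma-algebra they generate. *)
Lemma independent_of_grid_bounded A M L : <<s past W q >> A ->
  independent_of P A (grid_bounded (fun t => W (q + t) \- W q) M L n).
Proof.
move=> GA.
pose m := (L * 2 ^ n)%N.
pose C := [set D | exists2 B, (forall i, measurable (B i)) & D = rect m B].
have CI : setI_closed C.
  move=> _ _ [B1 mB1 ->] [B2 mB2 ->]; exists (fun i => B1 i `&` B2 i).
    by move=> i; exact: measurableI.
  by apply/seteqP; split => w /= => [[H1 H2] i im|H]; 
    [split; [exact: H1|exact: H2]|split => i /H[]].
have mC D : C D -> independent_of P A D.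
  move=> [B mB ->].
  have [G1 P1] := rect_indep m mB GA.
  (* Taking the whole space for [A] gives the probability of the rectangle alone. *)
  have [] := rect_indep m mB (@measurableT _ (g_sigma_algebraType (past W q))).
  rewrite setTI probability_setT mul1e => G2 P2.
  split; last first.
    rewrite setIC muleC P1; congr (_ * _)%E; exact/esym.
  apply: (history_measurable mW); apply: sub_sigma_algebra2 G2.
  by apply: past_history; rewrite (le_trans q0).
apply: (independent_of_generated CI (sW GA) mC).
have wincr i : (i < m)%N -> wrt <<s C >> (incr i).
  move=> im B mB; apply: sub_sigma_algebra.
  exists (fun j => if j == i then B else setT).
    by move=> j; case: ifP.
  apply/seteqP; split => w /=; last by move/(_ i im); rewrite eqxx.
  by move=> Bw j _; case: eqP => // ->.
apply: grid_bounded_measurable => i im.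
(* Each grid value is a telescoping sum of increments. *)
have -> : (W (q + i%:R / 2 ^+ n) \- W q)%R = (fun w => \sum_(j < i) incr j w).
  apply/funext => w; rewrite /= -(big_mkord predT (fun j => incr j w)).
  by rewrite telescope_sumr// /time mul0r addr0.
apply: (wrtP _ _).2.
apply: measurable_sum => j; apply: (wrtP _ _).1; apply: wincr.
by apply: leq_trans im.
Qed.

End BrownianGrid.

(** * Cadlag paths and clocks *)

Section Paths.
Context (R : realType).
Implicit Types (x v : R -> R) (t : R).

Definition right_cont x : Prop :=
  forall t, 0 <= t -> x s @[s --> t^'+] --> x t.

Definition cadlag x : Prop :=
  right_cont x /\ forall t, 0 < t -> cvg (x s @[s --> t^'-]).

(** For t >= 0, the least dyadic number of level [n] strictly above [t]; strictness makes right
    continuity applicable even at dyadic times. *)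
Definition dyadic_above (n : nat) t : R :=
  (Num.truncn (t * 2 ^+ n)).+1%:R / 2 ^+ n.

Lemma dyadic_above_gt n t : t < dyadic_above n t.
Proof. by rewrite ltr_pdivlMr ?exprn_gt0// truncnS_gt. Qed.

Lemma dyadic_above_le n t : 0 <= t -> dyadic_above n t <= t + (2 ^+ n)^-1.
Proof.
move=> t0; rewrite ler_pdivrMr ?exprn_gt0// mulrDl mulVf ?expf_neq0//.
rewrite -natr1 lerD2r.
by have /andP[] : _ := truncn_itv (mulr_ge0 t0 (exprn_ge0 n (ler0n R 2))).
Qed.

Lemma dyadic_above_cvg t : 0 <= t -> dyadic_above n t @[n --> \oo] --> t.
Proof.
move=> t0; apply: (@squeeze_cvgr _ _ _ _ (cst t) (fun n => t + (2 ^+ n)^-1)).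
- by near=> n; rewrite ltW ?dyadic_above_gt// dyadic_above_le.
- exact: cvg_cst.
- rewrite -[X in _ --> X]addr0; apply: cvgD; first exact: cvg_cst.
  have /= := @cvg_geometric R 1 2^-1.
  rewrite ger0_norm ?invr_ge0// invf_lt1// ltr1n => /(_ isT).
  apply: cvg_trans; apply: near_eq_cvg; near=> n.
  by rewrite /geometric /= mul1r exprVn.
Unshelve. all: by end_near. Qed.

Lemma right_cont_dyadic x t : right_cont x -> 0 <= t ->
  x (dyadic_above n t) @[n --> \oo] --> x t.
Proof.
move=> rx t0; have /cvg_at_rightP := rx t t0; apply; split.
  by move=> n; exact: dyadic_above_gt.
exact: dyadic_above_cvg.
Qed.

Lemma continuous_cadlag x : {within `[0, +oo[, continuous x} -> cadlag x.
Proof.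
move=> /continuous_within_itvcyP[cx x0]; split => t.
  rewrite le_eqVlt => /predU1P[<-//|t0].
  by apply: cvg_at_right_filter; apply: cx; rewrite in_itv/= t0.
move=> t0; apply/cvg_ex; exists (x t).
by apply: cvg_at_left_filter; apply: cx; rewrite in_itv/= t0.
Qed.

(** Right continuity and left limits bound the path on each side of every time; compactness of
    [0, L] makes the bound uniform. *)
Lemma cadlag_bounded x (L : R) : cadlag x ->
  exists M, forall t, 0 <= t <= L -> `|x t| <= M.
Proof.
move=> [rx lx].
(* Near covering is used with the filter of large bounds [M], so that finitely many local bounds are
   dominated at once. *)
have /compact_near_coveringP/(_ _ +oo_R
    (fun M t => 0 <= t -> `|x t| <= M)) := @segment_compact R 0 L.
case.
- move=> t /=; rewrite in_itv/= => /andP[t0 tL].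
  suff [M HM] : exists M, \forall s \near t, 0 <= s -> `|x s| <= M.
    exists ([set s | 0 <= s -> `|x s| <= M], [set m | M <= m]).
      by split => //; exact: nbhs_pinfty_ge (num_real _).
    by move=> [s m] /= [sM Mm] s0; apply: le_trans Mm; exact: sM.
  have [Mr HMr] : exists M, \forall s \near t^'+, `|x s| <= M.
    exists (`|x t| + 1); apply: cvgr_norm_le (rx t t0) _ _.
    by rewrite ltrDl.
  have [Ml HMl] : exists M, \forall s \near t^'-, 0 <= s -> `|x s| <= M.
    (* At t = 0 no s >= 0 lies to the left, so any bound serves. *)
    move: t0; rewrite le_eqVlt => /predU1P[<-|t0].
      exists 0; near=> s => s0; exfalso; move: s0; apply/negP; rewrite -ltNge.
      by near: s; exact: nbhs_left_lt.
    have /cvg_ex[l xl] := lx t t0; exists (`|l| + 1).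
    have : \forall s \near t^'-, `|x s| <= `|l| + 1.
      by apply: cvgr_norm_le xl _ _; rewrite ltrDl.
    by apply: filterS => s ? _.
  exists (Num.max (Num.max Ml Mr) `|x t|).
  move: HMl HMr; rewrite /at_left /at_right /within /= => HMl HMr.
  near=> s => s0; rewrite !le_max.
  have [st|ts|->] := ltgtP s t; last by rewrite lexx orbT.
    have -> // : `|x s| <= Ml by move: s0; move: st; near: s.
  have -> // : `|x s| <= Mr by move: ts; near: s.
  by rewrite orbT.
- move=> N [Nr HN]; exists (N + 1) => t tL.
  by apply: (HN (N + 1)); rewrite ?ltrDl// ?in_itv//; case/andP: tL.
Unshelve. all: by end_near. Qed.

(** Monotonicity keeps [f s] in [f t, +oo) for s > t. Since [f s] may equal [f t], convergence of
    [x] is taken within the closed half-line. *)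
Lemma right_cont_comp x (f : R -> R) : right_cont x ->
  right_cont f -> 0 <= f 0 ->
  (forall s t, 0 <= s -> s <= t -> f s <= f t) -> right_cont (x \o f).
Proof.
move=> rx rf f0 ndf t t0.
have ft0 : 0 <= f t by rewrite (le_trans f0)// ndf.
apply: cvg_comp (cvg_at_right_within (rx _ ft0)).
move=> A wA; have := rf t t0 _ wA.
rewrite /= /nbhs/= /at_right /within /=; apply: filterS => s /= H ts.
by apply: H => //; apply: ndf => //; exact: ltW.
Qed.

Lemma right_contD x y : right_cont x -> right_cont y ->
  right_cont (fun t => x t + y t).
Proof. by move=> rx ry t t0; apply: cvgD; [exact: rx|exact: ry]. Qed.

Lemma right_contZ c x :
  right_cont x -> right_cont (fun t => c * x t).
Proof. by move=> rx t t0; apply: cvgM; [exact: cvg_cst|exact: rx]. Qed.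

(** * Clocks as integrals of continuous rates *)

Section Clock.
Variables (v : R -> R) (c : R).
Hypotheses (cv : {within `[0, +oo[, continuous v})
  (vc : forall t, 0 <= t -> c <= v t).

Let mu := @lebesgue_measure R.
Let I t := \int[mu]_(s in `[0, t]) v s.

Let integrable_v a b : 0 <= a -> mu.-integrable `[a, b] (EFin \o v).
Proof.
move=> a0; apply: continuous_compact_integrable; first exact: segment_compact.
apply: continuous_subspaceW cv => s /=; rewrite !in_itv/= andbT => /andP[+ _].
exact: le_trans.
Qed.

(** Used with c = eps for the first clock, whose growth is bounded below, and with c = 0 for
    monotonicity of the second. *)
Lemma Rintegral_increment_ge s t :
  0 <= s -> s <= t -> c * (t - s) <= I t - I s.
Proof.
move=> s0 st; rewrite /I Rintegral_itvB ?bnd_simp//; last exact: integrable_v.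
rewrite Rintegral_itv_obnd_cbnd; last first.
  apply: integrableS (integrable_v t s0) => //.
  by apply: subset_itvr; rewrite bnd_simp.
have -> : c * (t - s) = \int[mu]_(r in `[s, t]) c.
  rewrite Rintegral_cst//; congr (_ * _).
  transitivity (fine (lebesgue_measure (`[s, t]%classic : set R))) => //.
  rewrite lebesgue_measure_itv/= lte_fin.
  move: st; rewrite le_eqVlt => /predU1P[->|->]; first by rewrite ltxx subrr.
  by rewrite -EFinB.
apply: le_Rintegral => //.
- apply: (@continuous_compact_integrable _ (cst c)).
    exact: segment_compact.
  by apply: continuous_subspaceT => ?; exact: cvg_cst.
- exact: integrable_v.
- move=> r /=; rewrite in_itv/= => /andP[sr _]; apply: vc.
  exact: le_trans sr.
Qed.

Lemma Rintegral_right_cont : right_cont I.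
Proof.
move=> t t0.
have b0 : 0 < t + 1 by rewrite ltr_wpDl.
have := parameterized_integral_continuous (ltW b0) (integrable_v (t + 1) (lexx 0)).
move/(continuous_within_itvP _ b0) => [cI I0 _].
move: t0; rewrite le_eqVlt => /predU1P[<-//|t0].
apply: cvg_at_right_filter; apply: cI.
by rewrite in_itv/= t0 ltrDl ltr01.
Qed.

Lemma Rintegral_at0 : I 0 = 0.
Proof. by rewrite /I set_itv1 Rintegral_set1. Qed.

End Clock.

End Paths.

(** * Measurability up to null sets *)

Section CompletedMeasurability.
Context d (T : measurableType d) (R : realType) (P : probability T R).
Variable G : set (set T).
Hypothesis GN : P.-negligible `<=` <<s G >>.
Implicit Types (Z : R -> T -> R) (f g theta : T -> R).

Let TG := g_sigma_algebraType G.

(** Preimages under [f] and [g] agree off a null set [N], and every subset of [N] is in [<<s G >>]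
    by completeness. *)
Lemma wrt_ae_eq f g : wrt <<s G >> f -> (\forall w \ae P, f w = g w) ->
  wrt <<s G >> g.
Proof.
move=> wf fg B mB.
pose N := ~` [set w | f w = g w].
have -> : g @^-1` B = (f @^-1` B `\` N) `|` (g @^-1` B `&` N).
  apply/seteqP; split => w /=.
    by move=> gB; have [Nw|/contrapT fgw] := pselect (N w);
      [right|left; split; [rewrite fgw|rewrite /N /= fgw]].
  by move=> [[fB /contrapT <-]|[]].
suff : measurable ((f @^-1` B `\` N) `|` (g @^-1` B `&` N) : set TG) by [].
apply: measurableU; first by apply: measurableD; [exact: wf|exact: GN].
by apply: GN; apply: negligibleS fg => w [].
Qed.

(** Irregular paths are replaced by 0. The result is, on t >= 0, the pointwise limit of its values
    at [dyadic_above n t], which depend only on w on each strip [k / 2^n, (k + 1) / 2^n). *)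
Lemma joint_version Z : (forall t, 0 <= t -> wrt <<s G >> (Z t)) ->
  (\forall w \ae P, right_cont (Z ^~ w)) ->
  exists2 Z' : T * R -> R, measurable_fun setT (Z' : TG * R -> R) &
    \forall w \ae P, forall t, 0 <= t -> Z' (w, t) = Z t w.
Proof.
move=> wZ rZ.
pose N := ~` [set w | right_cont (Z ^~ w)].
pose Z0 t w := if w \in N then 0 else Z t w.
have ZZ0 : \forall w \ae P, forall t, Z t w = Z0 t w.
  by apply: filterS rZ => w rw t; rewrite /Z0 memNset//; exact.
have wZ0 t : 0 <= t -> wrt <<s G >> (Z0 t).
  by move=> t0; apply: wrt_ae_eq (wZ t t0) _; apply: filterS ZZ0.
have rZ0 w : right_cont (Z0 ^~ w).
  rewrite /Z0; case: (boolP (w \in N)) => [wN|].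
    by move=> t t0; exact: cvg_cst.
  by rewrite notin_setE => /contrapT.
pose D := [set: TG] `*` `[(0:R), +oo[%classic.
have mD : measurable D by exact: measurableX.
have D_ge0 p : D p -> 0 <= p.2.
  by move=> /= -[_]; rewrite /= in_itv/= andbT.
exists ((fun p => Z0 p.2 p.1) \_ D); last first.
  apply: filterS ZZ0 => w Zw t t0; rewrite patchE mem_set ?Zw//.
  by split => //=; rewrite in_itv/= t0.
apply: (measurable_restrictT _ mD).1.
apply: (@measurable_fun_cvg _ _ _ _
  (fun n (p : TG * R) => Z0 (dyadic_above n p.2) p.1)); last first.
  by move=> p Dp; apply: (@right_cont_dyadic _ (Z0 ^~ p.1)) => //; exact: D_ge0.
move=> n.
pose E k := [set: TG] `*` `[k%:R / 2 ^+ n : R, k.+1%:R / 2 ^+ n[%classic.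
have p2 : 0 < 2 ^+ n :> R by rewrite exprn_gt0.
have -> : D = \bigcup_k E k.
  apply/seteqP; split => -[w t] [] /=.
    rewrite in_itv/= andbT => _ t0; exists (Num.truncn (t * 2 ^+ n)) => //.
    split => //=; rewrite in_itv/= ler_pdivrMr// ltr_pdivlMr//.
    by apply: truncn_itv; rewrite mulr_ge0// ltW.
  move=> k _ [] /= _; rewrite in_itv/= => /andP[kt _]; split => //=.
  by rewrite in_itv/= andbT (le_trans _ kt)// divr_ge0// ltW.
have mE k : measurable (E k) by exact: measurableX.
apply: ((measurable_fun_bigcup _ mE).2) => k.
apply: (@eq_measurable_fun _ _ _ _ _ (fun p : TG * R => Z0 (k.+1%:R / 2 ^+ n) p.1)).
  move=> [w t]; rewrite inE => -[] /= _; rewrite in_itv/= => /andP[kt tk].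
  rewrite /dyadic_above (@truncn_def _ _ k)//.
  by rewrite -ler_pdivrMr// -ltr_pdivlMr// kt tk.
apply: measurable_funTS; apply: measurableT_comp (measurable_fst).
by apply: (wrtP _ _).1; apply: wZ0; rewrite divr_ge0// ltW.
Qed.

(** Evaluation at a random time is the joint version composed with w |-> (w, theta w). It serves
    both stopping times and time changes. *)
Lemma wrt_compose Z theta : (forall t, 0 <= t -> wrt <<s G >> (Z t)) ->
  (\forall w \ae P, right_cont (Z ^~ w)) -> wrt <<s G >> theta ->
  (\forall w \ae P, 0 <= theta w) -> wrt <<s G >> (fun w => Z (theta w) w).
Proof.
move=> wZ rZ wtheta theta0.
have [Z' mZ' ZZ'] := joint_version wZ rZ.
apply: (@wrt_ae_eq (fun w => Z' (w, theta w))).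
  apply: (wrtP _ _).2; apply: measurableT_comp mZ' _.
  by apply: measurable_fun_pair => //; exact: (wrtP _ _).1.
by apply: filterS2 ZZ' theta0 => w /(_ (theta w)).
Qed.

Lemma wrt_clock Z t : (forall t, 0 <= t -> wrt <<s G >> (Z t)) ->
  (\forall w \ae P, right_cont (Z ^~ w)) ->
  (\forall w \ae P, forall t, 0 <= t -> 0 <= Z t w) ->
  wrt <<s G >> (clock Z t).
Proof.
move=> wZ rZ Z0; have [Z' mZ' ZZ'] := joint_version wZ rZ.
pose D := [set: TG] `*` `[(0:R), t]%classic.
have mD : measurable D by exact: measurableX.
(* Tonelli asks for a function nonnegative everywhere, whereas [Z'] is so only almost surely; the
   absolute value repairs this without changing the integral almost surely. *)
pose f := (fun p : TG * R => `|Z' p|%:E) \_ D.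
have mf : measurable_fun setT f.
  apply: (measurable_restrictT _ mD).1; apply: measurable_funTS.
  by apply/measurable_EFinP; apply: measurableT_comp mZ'.
have f0 p : (0%R <= f p)%E.
  by rewrite /f patchE; case: ifP => // _; rewrite lee_fin.
have mF := @measurable_fun_fubini_tonelli_F _ _ TG _ R (@lebesgue_measure R) f mf f0.
apply: (@wrt_ae_eq (fun w => fine (fubini_F (@lebesgue_measure R) f w))).
  by apply: (wrtP _ _).2; apply: measurableT_comp mF.
apply: filterS2 ZZ' Z0 => w ZZ'w Z0w.
rewrite /clock /Rintegral /fubini_F [in RHS]integral_mkcond; congr fine.
apply: eq_integral => s _; rewrite /f !patchE.
have -> : ((w, s) \in D) = (s \in `[0, t]%classic).
  by rewrite /D in_setX in_setT.
case: ifPn => //; rewrite inE/= in_itv/= => /andP[s0 _].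
by rewrite ZZ'w// ger0_norm// Z0w.
Qed.

End CompletedMeasurability.

(** * Brownian excursions of positive probability *)

Lemma normal_prob_neq0 (R : realType) (m s c : R) (A : set R) : s != 0 ->
  measurable A -> `[c, c + 1]%classic `<=` A -> normal_prob m s A != 0%E.
Proof.
move=> s0 mA cA; rewrite /normal_prob.
have pdf_gt0 x : 0 < normal_pdf m s x.
  by rewrite normal_pdfE//= mulr_gt0 ?expR_gt0// normal_peak_gt0.
have cc1 : c <= c + 1 by rewrite lerDl.
(* The positive minimum of the density on the unit interval bounds the probability from below. *)
have [x0 _ Hx0] := @EVT_min R (normal_pdf m s) c (c + 1) cc1
  (continuous_subspaceT (continuous_normal_pdf s0)).
suff : (0 < \int[lebesgue_measure]_(x in A) (normal_pdf m s x)%:E)%E.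
  by move/gt_eqF => ->.
have mpdf (D : set R) : measurable_fun D (EFin \o normal_pdf m s).
  by apply: measurable_funTS; apply/measurable_EFinP; exact: measurable_normal_pdf.
apply: (@lt_le_trans _ _
  (\int[lebesgue_measure]_(x in `[c, (c + 1)%R]) (normal_pdf m s x0)%:E)%E).
  rewrite integral_cst//= lebesgue_measure_itv/= lte_fin ltrDl ltr01.
  by rewrite -EFinB addrAC subrr add0r mule1 lte_fin.
apply: (@le_trans _ _
  (\int[lebesgue_measure]_(x in `[c, (c + 1)%R]) (normal_pdf m s x)%:E)%E).
  apply: ge0_le_integral => //.
  - by move=> x _; rewrite lee_fin ltW.
  - exact: mpdf.
apply: ge0_subset_integral => //; first exact: mpdf.
by move=> x _; rewrite lee_fin ltW.
Qed.

Section GridPaths.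
Context d (T : measurableType d) (R : realType).
Implicit Types (X : R -> T -> R).

(** The bound passes to the limit along dyadic times decreasing to [t]; the unit of room in t + 1 <=
    N keeps these times on the grid. *)
Lemma grid_bounded_path X M N w t : right_cont (X ^~ w) ->
  (\bigcap_n grid_bounded X M N n) w -> 0 <= t -> t + 1 <= N%:R ->
  `|X t w| <= M.
Proof.
move=> rX HX t0 tN.
have cX : `|X (dyadic_above n t) w| @[n --> \oo] --> `|X t w|.
  by apply: cvg_norm; exact: (right_cont_dyadic rX t0).
apply: (cvgr_to_le cX).
near=> n; apply: (HX n I).
rewrite -(ler_nat R) natrM natrX -ler_pdivrMr ?exprn_gt0//.
apply: le_trans tN; apply: (le_trans (dyadic_above_le n t0)).
by rewrite lerD2l invf_le1 ?exprn_gt0// exprn_ege1// ler1n.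
Unshelve. all: by end_near. Qed.

Lemma bounded_grid X M N w : (forall t, 0 <= t <= N%:R -> `|X t w| <= M) ->
  (\bigcap_n grid_bounded X M N n) w.
Proof.
move=> HX n _ i iN; apply: HX; rewrite divr_ge0 ?exprn_ge0//=.
by rewrite ler_pdivrMr ?exprn_gt0// -natrX -natrM ler_nat.
Qed.

End GridPaths.

Section BrownianExcursion.
Context d (T : measurableType d) (R : realType) (P : probability T R).

(** The event [E] combines a large Gaussian increment on [a, a + eta] with a bounded oscillation of
    [W] afterwards. Both have positive probability, and the oscillation is independent of the past
    of a + eta. *)
Lemma brownian_excursion (W : R -> T -> R) (a eta b K L : R) :
  brownian_motion P W -> 0 <= a -> 0 < eta -> b != 0 ->
  exists E, [/\ <<s history W >> E, P E != 0%E,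
    <<s past W a >> `<=` independent_of P E &
    \forall w \ae P, E w ->
      forall r, a + eta <= r <= L -> b * (W r w - W a w) < - K].
Proof.
move=> [mW _ cW iW gW] a0 eta0 b0.
pose q := a + eta.
have aq : a < q by rewrite ltrDl.
have q0 : 0 <= q by rewrite (le_trans a0)// ltW.
pose X t := (W (q + t) \- W q)%R.
(* One unit rounds [L] up, the other is the room asked for by [grid_bounded_path]. *)
pose N := (Num.truncn L).+2.
pose D M := \bigcap_n grid_bounded X M N n.
have cadW : \forall w \ae P, cadlag (W ^~ w).
  by apply: filterS cW => w; exact: continuous_cadlag.
have rX : \forall w \ae P, right_cont (X ^~ w).
  apply: filterS cadW => w [rW _].
  apply: right_contD; last by move=> t t0; exact: cvg_cst.
  apply: (@right_cont_comp _ (W ^~ w) (fun t => q + t)) => //.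
  - by move=> t t0; apply: cvgD; [exact: cvg_cst|exact: cvg_at_right_filter].
  - by rewrite addr0.
  - by move=> s t _ st; rewrite lerD2l.
have iD M A : <<s past W q >> A -> independent_of P A (D M).
  move=> GA; apply: independent_of_bigcap.
  - apply: (history_measurable mW).
    by apply: sub_sigma_algebra2 GA; exact: past_history.
  - exact: grid_bounded_nonincreasing.
  - by move=> n; exact: independent_of_grid_bounded.
have mD M : measurable (D M).
  by have [] := iD M set0 (@sigma_algebra0 _ _ _).
(* Cadlag paths are bounded on compact intervals, so the events [D k] cover almost every path and
   cannot all be null. *)
have [M PDM] : exists M, P (D M) != 0%E.
  apply/not_existsP => H.
  have : P.-negligible (\bigcup_(k : nat) D k%:R).
    apply: negligible_bigcup => k; apply/negligibleP => //.
    by have /negP := H k%:R; rewrite negbK => /eqP.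
  move=> /(negligibleU cadW) [S [mS PS HS]].
  have : P setT = 0%E.
    apply/eqP; rewrite -measure_le0 -PS le_measure ?inE// => w _.
    apply: HS => /=; have [cw|] := pselect (cadlag (W ^~ w)); last by left.
    right; have [M HM] := cadlag_bounded (q + N%:R) cw.
    exists (Num.truncn (M + M)).+1 => //; apply: bounded_grid => t /andP[t0 tN].
    apply: le_trans (ltW (truncnS_gt _)); rewrite /X /=.
    apply: (le_trans (ler_normB _ _)); apply: lerD; apply: HM.
      by rewrite addr_ge0//= lerD2l.
    by rewrite q0/= lerDl.
  by rewrite probability_setT => -[/eqP]; rewrite oner_eq0.
(* The extra |b| M absorbs the oscillation allowed by [D M] after time [q]. *)
pose B := [set y | b * y < - (K + `|b| * M)].
have mB : measurable B.
  have -> : B = (fun y => b * y) @^-1` `]-oo, - (K + `|b| * M)[.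
    by apply/seteqP; split => y /=; rewrite in_itv.
  by rewrite -[_ @^-1` _]setTI; apply: measurable_funM.
pose U := (W q \- W a)%R @^-1` B.
have GU : <<s past W q >> U.
  suff : wrt <<s past W q >> (W q \- W a)%R by apply.
  apply: (wrtP _ _).2; apply: measurable_funB; apply: (wrtP _ _).1;
    apply: wrt_past; first by rewrite q0 lexx.
  by rewrite a0 ltW.
have PU : P U != 0%E.
  rewrite /U gW//.
  pose z := (K + `|b| * M) / b.
  (* [B] is the half-line below or above -z, according to the sign of [b]; [c, c + 1] lies inside
     it. *)
  pose c := if 0 < b then - z - 2 else - z + 1.
  apply: (@normal_prob_neq0 _ _ _ c) => //.
    by rewrite gt_eqF// sqrtr_gt0 subr_gt0.
  move=> y /=; rewrite in_itv/= /B/= /c => /andP[].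
  have zE : K + `|b| * M = b * z by rewrite /z [RHS]mulrC divfK.
  rewrite zE -(mulrN b z); case: ifPn => [bp cy yc|].
    by rewrite ltr_pM2l//; lra.
  rewrite -leNgt => bn cy yc; have {}bn : b < 0 by rewrite lt_neqAle b0.
  by rewrite ltr_nM2l//; lra.
have mU : measurable U.
  by apply: (history_measurable mW); apply: sub_sigma_algebra2 GU; exact: past_history.
exists (U `&` D M); split.
- suff : measurable (U `&` D M : set (g_sigma_algebraType (history W))) by [].
  apply: measurableI.
    by apply: sub_sigma_algebra2 GU; exact: past_history.
  apply: bigcapT_measurable => n; apply: grid_bounded_measurable => i _.
  have t0 : 0 <= i%:R / 2 ^+ n :> R by rewrite divr_ge0// exprn_ge0.
  have wW t : 0 <= t -> wrt <<s history W >> (W t).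
    move=> t1; apply: (@wrt_sub _ _ _ (past W t)); last by apply: wrt_past; rewrite t1 lexx.
    by apply: sub_sigma_algebra2; exact: past_history.
  by apply: (wrtP _ _).2; apply: measurable_funB; apply: (wrtP _ _).1; apply: wW => //;
    exact: addr_ge0.
- have [_ ] := iD M _ GU; rewrite setIC => ->.
  by rewrite mule_eq0 negb_or PDM.
- move=> A GA; split.
    by apply: (history_measurable mW); apply: sub_sigma_algebra2 GA; exact: past_history.
  have GAq : <<s past W q >> A.
    by apply: sub_sigma_algebra2 GA; apply: sub_past; exact: ltW.
  have GAU : <<s past W q >> (A `&` U).
    suff : measurable (A `&` U : set (g_sigma_algebraType (past W q))) by [].
    exact: measurableI.
  (* [D M] is independent of the past of [q], which contains both [U] and [A] cut with [U]; [U] is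
     independent of the past of [a]. Hence the three probabilities multiply. *)
  have [_ e1] := iD M _ GAU; have [_ e2] := iD M _ GU.
  rewrite setIA setIC e1 [U `&` _]setIC e2 muleCA.
  by rewrite [P (A `&` U)](iW _ _ a0 aq)// muleC.
- apply: filterS rX => w rw [Uw Dw] r /andP[qr rL].
  have rq0 : 0 <= r - q by rewrite subr_ge0.
  have rN : r - q + 1 <= N%:R.
    rewrite /N -natr1 lerD2r; apply: le_trans (ltW (truncnS_gt L)).
    by rewrite lerBlDr (le_trans rL)// lerDl.
  have := grid_bounded_path rw Dw rq0 rN; rewrite /X /= [q + _]addrC subrK => HX.
  have : b * (W r w - W q w) <= `|b| * M.
    by rewrite (le_trans (ler_norm _))// normrM ler_wpM2l.
  move: Uw; rewrite /U /B /= => Uw bWM.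
  have -> : b * (W r w - W a w) = b * (W r w - W q w) + b * (W q w - W a w).
    by ring.
  by lra.
Qed.

End BrownianExcursion.

(** * Stopping times and the no arbitrage criterion *)

Section SigmaAlgebraSets.
Context (T : pointedType).
Variable M : set (set T).
Hypothesis sM : sigma_algebra setT M.
Implicit Types A B : set T.

Let ME : M = (measurable : set (set (g_sigma_algebraType M))).
Proof. by rewrite measurable_g_measurableTypeE. Qed.

Lemma sigma_algebra_setI A B : M A -> M B -> M (A `&` B).
Proof. by rewrite ME; exact: measurableI. Qed.

Lemma sigma_algebra_setD A B : M A -> M B -> M (A `\` B).
Proof. by rewrite ME; exact: measurableD. Qed.

End SigmaAlgebraSets.

Lemma right_cont_minl (R : realType) (t : R) : right_cont (fun s => Num.min s t).
Proof.
move=> s _; have [st|ts] := ltP s t.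
  apply: (@cvg_trans _ (id r @[r --> s^'+])); last exact: cvg_at_right_filter.
  apply: near_eq_cvg; near=> r; rewrite min_l//.
  by near: r; exact: nbhs_right_le.
apply: (@cvg_trans _ (cst t r @[r --> s^'+])); last exact: cvg_cst.
apply: near_eq_cvg; near=> r; rewrite min_r//; apply: (le_trans ts).
by near: r; exact: nbhs_right_ge.
Unshelve. all: by end_near. Qed.

Section StoppingTimes.
Context d (T : measurableType d) (R : realType) (P : probability T R).
Variable G : R -> set (set T).
Let F := augmented P G.
Implicit Types (tau sigma : T -> R) (S : R -> T -> R).

Lemma sigma_algebra_augmented t : sigma_algebra setT (F t).
Proof.
split=> [u tu|A FA u tu|A FA u tu]; first exact: sigma_algebra0.
  by apply: sigma_algebraCD; exact: FA.
by apply: sigma_algebra_bigcup => n; exact: FA.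
Qed.

Lemma sub_augmented s t : s <= t -> F s `<=` F t.
Proof. by move=> st A FA u tu; apply: FA; exact: le_lt_trans tu. Qed.

Lemma sigma_algebra_stopped tau :
  stopping_time F tau -> sigma_algebra setT (stopped F tau).
Proof.
move=> [tau0 Ftau]; split=> [t t0|A FA t t0|A FA t t0].
- by rewrite set0I; have [] := sigma_algebra_augmented t.
- have -> : (setT `\` A) `&` [set w | tau w <= t] =
      [set w | tau w <= t] `\` (A `&` [set w | tau w <= t]).
    by apply/seteqP; split => w /=; tauto.
  apply: (sigma_algebra_setD (sigma_algebra_augmented t)); first exact: Ftau.
  exact: FA.
- rewrite setI_bigcupl; have [_ _] := sigma_algebra_augmented t; apply => n.
  exact: FA.
Qed.

Lemma sub_stopped tau sigma : stopping_time F sigma ->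
  (forall w, tau w <= sigma w) -> stopped F tau `<=` stopped F sigma.
Proof.
move=> [_ Fsigma] ts A FA t t0.
have -> : A `&` [set w | sigma w <= t] =
    (A `&` [set w | tau w <= t]) `&` [set w | sigma w <= t].
  by apply/seteqP; split => w /=; [move=> [Aw st]; split => //; split => //;
    exact: le_trans st|move=> [[]]].
apply: (sigma_algebra_setI (sigma_algebra_augmented t)); first exact: FA.
exact: Fsigma.
Qed.

Lemma wrt_min_stopping_time tau t : stopping_time F tau -> 0 <= t ->
  wrt (F t) (fun w => Num.min (tau w) t).
Proof.
move=> [tau0 Ftau] t0.
rewrite -[F t](sigma_algebra_id (sigma_algebra_augmented t)).
apply: (wrtP _ _).2 => mT.
apply: (measurability _ (RGenOInfty.measurableE R)) => //.
move=> _ [_ [x ->] <-]; rewrite setTI.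
suff FC : F t (~` ((fun w => Num.min (tau w) t) @^-1` `]x, +oo[)).
  rewrite -[X in _ X]setCK; apply: measurableC.
  exact: sub_sigma_algebra.
have -> : ~` ((fun w => Num.min (tau w) t) @^-1` `]x, +oo[) =
    [set w | Num.min (tau w) t <= x].
  by apply/seteqP; split => w /=; [move/negP|move=> mx; apply/negP; move: mx];
    rewrite in_itv/= andbT -leNgt.
have [tx|xt] := leP t x.
  suff -> : [set w | Num.min (tau w) t <= x] = ~` set0.
    by rewrite -setTD; have [? HC _] := sigma_algebra_augmented t; exact: HC.
  by apply/seteqP; split => w /=; [move=> _ []|rewrite ge_min tx orbT].
have -> : [set w | Num.min (tau w) t <= x] = [set w | tau w <= x].
  by apply/seteqP; split => w /=; rewrite ge_min [t <= x]leNgt xt orbF.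
have [x0|x0] := leP 0 x; first by apply: (sub_augmented (ltW xt)); exact: Ftau.
suff -> : [set w | tau w <= x] = set0.
  by have [] := sigma_algebra_augmented t.
by apply/seteqP; split => w //=; rewrite leNgt (lt_le_trans x0 (tau0 w)).
Qed.

(** On {tau <= t} the value at [tau] is that of the process stopped at [t], evaluated at min(tau,
    t). *)
Lemma wrt_stopped S tau :
  (forall t u, 0 <= t <= u -> wrt <<s G u >> (S t)) ->
  (\forall w \ae P, right_cont (S ^~ w)) -> stopping_time F tau ->
  wrt (stopped F tau) (fun w => S (tau w) w).
Proof.
move=> GS rS st B mB t t0 u tu.
(* The inner minimum makes the random time known at [t]; the outer one stops the process, so that
   all its values are known at [u]. *)
have -> : (fun w => S (tau w) w) @^-1` B `&` [set w | tau w <= t] =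
    (fun w => S (Num.min (Num.min (tau w) t) t) w) @^-1` B `&`
    [set w | tau w <= t].
  by apply/seteqP; split => w /= [Bw wt]; split => //; move: Bw;
    rewrite !(min_l wt).
pose H := <<s G u `|` P.-negligible >>.
have sH : sigma_algebra setT H by exact: smallest_sigma_algebra.
apply: (sigma_algebra_setI sH); last by apply: st.2.
suff : wrt H (fun w => S (Num.min (Num.min (tau w) t) t) w) by apply.
apply: (@wrt_compose _ _ _ P _ _ (fun s w => S (Num.min s t) w)).
- by move=> A NA; apply: sub_sigma_algebra; right.
- move=> s s0; apply: wrt_sub (GS (Num.min s t) u _).
    by apply: sub_sigma_algebra2 => A; left.
  by rewrite le_min s0 t0/= ge_min (ltW tu) orbT.
- apply: filterS rS => w rw.
  apply: (@right_cont_comp _ (S ^~ w) (fun s => Num.min s t)) => //.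
  + exact: right_cont_minl.
  + by rewrite le_min lexx.
  + by move=> r s _ rs; rewrite le_min !ge_min rs lexx orbT.
- by move=> D mD; exact: (wrt_min_stopping_time st t0 mD tu).
- by apply: aeW => w; rewrite le_min t0 andbT; exact: st.1.
Qed.

(** The sign of [b] is that of a position, so that long and short positions are treated together. *)
Definition crossing S (b u v C : R) : set T :=
  [set w | forall r t, 0 <= r <= u -> v <= t <= C -> b * (S t w - S r w) < 0].

(* Sets known at time [u] are only measurable up to null sets, hence the
   phrasing with negligible sets instead of conditional probabilities. *)
Definition conditional_crossing S : Prop :=
  forall b u v C A, b != 0 -> 0 <= u -> u < v ->
  <<s G u `|` P.-negligible >> A ->
  P.-negligible (A `&` crossing S b u v C) -> P.-negligible A.

(** Cells of length delta = h / 4 replace random dates by fixed ones: if [tau] lies in the cell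
    ending at i delta, then sigma >= tau + h >= (i + 3) delta, which is u + 2 delta. *)
Lemma conditional_crossing_stopped S tau sigma h C A b :
  conditional_crossing S -> stopping_time F tau -> stopped F tau A -> 0 < h ->
  (\forall w \ae P, h <= sigma w - tau w) -> (forall w, sigma w <= C) ->
  b != 0 ->
  P.-negligible (A `&` [set w | b * (S (sigma w) w - S (tau w) w) < 0]) ->
  P.-negligible A.
Proof.
move=> cS [tau0 Ftau] FA h0 gap sC b0 NA.
pose delta := h / 4; have delta0 : 0 < delta by rewrite divr_gt0.
pose E i := A `&` [set w | tau w <= i%:R * delta] `\`
  (if i is j.+1 then [set w | tau w <= j%:R * delta] else set0).
have id0 i : 0 <= i%:R * delta by rewrite mulr_ge0// ltW.
have NE i : P.-negligible (E i).
  (* Events of the right-continuous filtration at i delta are known only at strictly later times,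
     hence the additional [delta]. *)
  pose u := i%:R * delta + delta.
  apply: (@cS b u (u + 2 * delta) C) => //.
  - by rewrite addr_ge0// ltW.
  - by rewrite ltrDl mulr_gt0.
  - apply: (sigma_algebra_setD (smallest_sigma_algebra _ _)).
      by apply: FA => //; rewrite ltrDl.
    case: i @u => [u|j u]; first exact: sigma_algebra0.
    apply: Ftau => //; rewrite /u -natr1 mulrDl mul1r -addrA ltrDl.
    by rewrite addr_gt0.
  apply: negligibleS (negligibleU NA gap) => w /= [[[Aw wi] nwi] cw].
  have [hw|] := pselect (h <= sigma w - tau w); last by right.
  left; split => //; apply: cw.
    by rewrite tau0 (le_trans wi)// lerDl ltW.
  rewrite sC andbT.
  have : i%:R * delta - delta <= tau w.
    case: i @u wi nwi => [u wi _|j u wi].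
      by rewrite mul0r sub0r; apply: le_trans (tau0 w); rewrite oppr_le0 ltW.
    move=> /negP; rewrite -ltNge => /ltW; apply: le_trans.
    by rewrite -natr1 mulrDl mul1r addrK.
  have hd : h = 4 * delta by rewrite /delta; field.
  by rewrite /u; lra.
apply: negligibleS (negligible_bigcup NE) => w Aw.
have ex : exists i, tau w <= i%:R * delta.
  exists (Num.truncn (tau w / delta)).+1.
  by rewrite -ler_pdivrMr// ltW// truncnS_gt.
case: (ex_minnP ex) => i wi imin; exists i => //; split => //.
case: i wi imin => [_ _ []|j _ imin wj].
by have := imin j wj; rewrite ltnn.
Qed.

(** Nonnegative final gain is propagated backwards through the trades, and vanishing gain
    forwards. *)
Lemma no_arbitrage_of_crossing S :
  (forall t u, 0 <= t <= u -> wrt <<s G u >> (S t)) ->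
  (\forall w \ae P, right_cont (S ^~ w)) -> conditional_crossing S ->
  no_arbitrage P F (cheridito P F) S.
Proof.
move=> GS rS cS; split.
  move=> t t0 B mB u tu; move: B mB; apply: wrt_sub (GS t u _).
    by apply: sub_sigma_algebra2 => A; left.
  by rewrite t0 ltW.
apply/seteqP; split => [f [[mf [H [h /= h0 [[n2 st dle [C HC] gpos] gap]] fE]] [_ f0]]|].
  split => //.
  pose V k (w : T) : R := \sum_(1 <= j < k)
    pos H j w * (S (date H j.+1 w) w - S (date H j w) w).
  have wS j : (1 <= j <= ndates H)%N ->
      wrt (stopped F (date H j)) (fun w => S (date H j w) w).
    by move=> jn; apply: wrt_stopped => //; exact: st.
  have ss j : (1 <= j <= ndates H)%N -> sigma_algebra setT (stopped F (date H j)).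
    by move=> jn; exact: sigma_algebra_stopped (st j jn).
  have sub j : (1 <= j < ndates H)%N ->
      stopped F (date H j) `<=` stopped F (date H j.+1).
    move=> /andP[j1 jn]; apply: sub_stopped; first by apply: st; rewrite jn.
    by move=> w; apply: dle; rewrite j1.
  have dateC j w : (1 <= j <= ndates H)%N -> date H j w <= C.
    move=> /andP[j1 jn]; apply: le_trans (HC w).
    have := dle; move: jn; elim: (ndates H) => [|m IH].
      by move: j1; case: (j).
    rewrite leq_eqVlt => /predU1P[<-//|jm] dle'.
    have {}dle' k v : (1 <= k < m.+1)%N -> date H k v <= date H k.+1 v by exact: dle'.
    apply: le_trans (dle' m w _); last by rewrite (leq_trans j1)//=.
    by apply: IH => // k v /andP[k1 km]; apply: dle'; rewrite k1 ltnW.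
  (* Measurability of [V k] at date k is part of the induction, since {V_k <= 0} must be known when
     the k-th position is taken. *)
  have claim k : (1 <= k <= ndates H)%N ->
      wrt (stopped F (date H k)) (V k) /\
      ((\forall w \ae P, 0 <= V k w) -> \forall w \ae P, V k w = 0).
    elim: k => // k IH; rewrite ltnS => /andP[_ kn].
    have [->|k0] := posnP k.
      have V1 w : V 1 w = 0 by rewrite /V big_geq.
      split; last by move=> _; exact: aeW.
      have -> : V 1 = cst 0 by apply/funext => w; exact: V1.
      rewrite -[stopped _ _](sigma_algebra_id (ss 1%N _)) ?(ltnW n2)//.
      by apply: (wrtP _ _).2; exact: measurable_cst.
    have k1n : (1 <= k < ndates H)%N by rewrite k0 kn.
    have k1n' : (1 <= k <= ndates H)%N by rewrite k0 ltnW.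
    have [wV V0] := IH k1n'.
    have VS w : V k.+1 w =
        V k w + pos H k w * (S (date H k.+1 w) w - S (date H k w) w).
      by rewrite /V big_nat_recr.
    have gen g j : (1 <= j <= ndates H)%N ->
        wrt (stopped F (date H j)) g ->
        measurable_fun setT (g : g_sigma_algebraType (stopped F (date H j)) -> R).
      move=> jn wg; apply: (wrtP _ _).1 => B mB; apply: sub_sigma_algebra.
      exact: wg.
    split.
      have -> : V k.+1 = (fun w => V k w +
          pos H k w * (S (date H k.+1 w) w - S (date H k w) w)).
        by apply/funext => w; exact: VS.
      rewrite -[stopped _ _](sigma_algebra_id (ss k.+1 _))//.
      apply: (wrtP _ _).2; apply: measurable_funD.
        by apply: gen => // B mB; apply: sub => //; exact: wV.
      apply: measurable_funM.
        by apply: gen => // B mB; apply: sub => //; exact: gpos.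
      apply: measurable_funB; apply: gen => //; first exact: wS.
      by move=> B mB; apply: sub => //; exact: wS.
    move=> V1.
    (* On this set a crossing would make V_(k+1) negative. The values 1 and -1 of [b] then exclude
       both signs of the position. *)
    have key b : b != 0 ->
        \forall w \ae P, ~ (V k w <= 0 /\ 0 < b * pos H k w).
      move=> b0; rewrite /almost_everywhere.
      pose A := [set w | V k w <= 0 /\ 0 < b * pos H k w].
      suff NA : P.-negligible A.
        apply: negligibleS NA => w /=; exact: contrapT.
      apply: (@conditional_crossing_stopped S (date H k) (date H k.+1) h C A b) => //.
      - exact: st.
      - rewrite -[stopped _ _](sigma_algebra_id (ss k k1n')).
        have -> : A = (V k @^-1` `]-oo, 0]) `&`
            ((fun w => b * pos H k w) @^-1` `]0, +oo[).
          by apply/seteqP; split => w /=; rewrite !in_itv/= andbT.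
        suff : measurable ((V k @^-1` `]-oo, 0]) `&`
            ((fun w => b * pos H k w) @^-1` `]0, +oo[) :
            set (g_sigma_algebraType (stopped F (date H k)))) by [].
        apply: measurableI; rewrite -[_ @^-1` _]setTI.
          by apply: (gen (V k)).
        apply: (measurable_funM (measurable_cst b) (gen _ _ k1n' (gpos k k1n))) => //.
      - by apply: filterS gap => w; exact.
      - by move=> w; apply: dateC.
      apply: negligibleS V1 => w /= -[[Vk0 bg] bS]; rewrite VS; apply/negP.
      rewrite -ltNge.
      suff : pos H k w * (S (date H k.+1 w) w - S (date H k w) w) < 0 by lra.
      (* Multiplying by b * b splits the last gain into two factors of known sign. *)
      have bb : 0 < b * b by rewrite -expr2 exprn_even_gt0.
      rewrite -(pmulr_rlt0 _ bb).
      have -> : b * b * (pos H k w * (S (date H k.+1 w) w - S (date H k w) w)) =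
        (b * pos H k w) * (b * (S (date H k.+1 w) w - S (date H k w) w)) by ring.
      by rewrite pmulr_rlt0.
    have k1 : \forall w \ae P, V k w <= 0 -> pos H k w = 0.
      apply: filterS2 (key 1 (oner_neq0 _)) (key (-1) _); last first.
        by rewrite oppr_eq0 oner_eq0.
      move=> w; rewrite mul1r mulN1r oppr_gt0 => g1 g2 Vk0.
      by apply/eqP; rewrite eq_le !leNgt; apply/andP; split; apply/negP => ?;
        [apply: g1|apply: g2].
    have {}V0 : \forall w \ae P, V k w = 0.
      apply: V0; apply: filterS2 V1 k1 => w; rewrite VS => Vk1 gk0.
      rewrite leNgt; apply/negP => Vk0; move: Vk1.
      by rewrite (gk0 (ltW Vk0)) mul0r addr0 leNgt Vk0.
    apply: filterS2 V0 k1 => w Vk0; rewrite VS Vk0 => -> //.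
    by rewrite mul0r addr0.
  have [|_ Vn0] := claim (ndates H); first by rewrite leqnn ltnW.
  have : \forall w \ae P, 0 <= V (ndates H) w.
    by apply: filterS2 fE f0 => w; rewrite /gain => ->.
  move=> /Vn0 Vn; apply: filterS2 fE Vn => w; rewrite /gain => ->.
  exact.
move=> f [mf f0]; split; last by split => //; apply: filterS f0 => w ->.
split => //.
(* Conversely, zero gain is attained by null positions between the dates 1 and 2. *)
pose H := Strategy 2 0 (fun j (w : T) => j%:R : R) (fun _ (w : T) => 0 : R).
exists H; last first.
  apply: filterS f0 => w ->; rewrite /gain big1// => i _.
  by rewrite /= mul0r.
have Fcst t (Q : Prop) : F t [set w : T | Q].
  have [F0 FC _] := sigma_algebra_augmented t.
  have [q|nq] := pselect Q.
    have -> : [set w : T | Q] = setT `\` set0 by apply/seteqP; split => w //= _; split.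
    exact: FC.
  by have -> : [set w : T | Q] = set0 by apply/seteqP; split.
exists 1 => /=; first exact: ltr01.
split; first split => //=.
- by move=> j w _; rewrite ler_nat leqnSn.
- by exists 2%:R.
- move=> j _ B mB t t0.
  by apply: (sigma_algebra_setI (sigma_algebra_augmented t)); exact: Fcst.
- by apply: aeW => w j _; rewrite -natrB// subSnn.
Qed.

End StoppingTimes.

(** * The time-changed process *)

Section FourSigmaAlgebras.
Context d (T : measurableType d) (R : realType) (P : probability T R).
Implicit Types (X : R -> T -> R) (A : set T).

Definition independent4 (F1 F2 F3 F4 : set (set T)) : Prop :=
  forall A1 A2 A3 A4, F1 A1 -> F2 A2 -> F3 A3 -> F4 A4 ->
  P (A1 `&` A2 `&` A3 `&` A4) = (P A1 * P A2 * P A3 * P A4)%E.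

(** The whole space in the place of [B4] leaves independence of three motions; [X] then splits off
    by its independence of their join. *)
Lemma independent4_of_mutual (B1 B2 B3 B4 X : R -> T -> R) :
  mutually_independent P (fun i : 'I_4 =>
    <<s history (tnth [tuple B1; B2; B3; B4] i) >>) ->
  independent P <<s history X >>
    <<s history B1 `|` history B2 `|` history B3 >> ->
  independent4 <<s history B1 >> <<s history B2 >> <<s history X >>
    <<s history B3 >>.
Proof.
move=> mi ix A1 A2 A3 A4 G1 G2 G3 G4.
have P3 : P (A1 `&` A2 `&` A4) = (P A1 * P A2 * P A4)%E.
  pose E (i : 'I_4) := match val i with 0%N => A1 | 1%N => A2 | 2%N => A4
    | _ => setT end.
  have := mi [set: 'I_4]%SET E.
  have -> : \bigcap_(i in [set` [set: 'I_4]%SET]) E i = A1 `&` A2 `&` A4.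
    apply/seteqP; split => w /=.
      move=> H; split; first split.
      - by apply: (H (@Ordinal 4 0 isT)); rewrite /= inE.
      - by apply: (H (@Ordinal 4 1 isT)); rewrite /= inE.
      - by apply: (H (@Ordinal 4 2 isT)); rewrite /= inE.
    by move=> [[? ?] ?] [[|[|[|[|//]]]] ilt] _.
  rewrite (eq_bigl predT); last by move=> i; rewrite inE.
  rewrite !big_ord_recr/= big_ord0 /E /= mul1e probability_setT mule1; apply.
  move=> [[|[|[|[|//]]]] ilt] _; rewrite (tnth_nth B1)//=.
  exact: (@measurableT _ (g_sigma_algebraType (history B4))).
have -> : A1 `&` A2 `&` A3 `&` A4 = A3 `&` (A1 `&` A2 `&` A4).
  by apply/seteqP; split => w /=; tauto.
rewrite ix//; first by rewrite P3 -!muleA (muleCA (P A3)) (muleCA (P A3)).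
suff : measurable (A1 `&` A2 `&` A4 : set (g_sigma_algebraType
  (history B1 `|` history B2 `|` history B3))) by [].
apply: measurableI; first apply: measurableI.
- by apply: sub_sigma_algebra2 G1 => S; left; left.
- by apply: sub_sigma_algebra2 G2 => S; left; right.
- by apply: sub_sigma_algebra2 G4 => S; right.
Qed.

(** Meant for [H] the history of W and [H4] its past at some time. On the pi-system of fourfold
    intersections, A4 cut with [E] is still an event of [H], so the two independence assumptions
    combine. *)
Lemma independent_of_join4 (H1 H2 H3 H4 H : set (set T)) E :
  <<s H1 >> `<=` measurable -> <<s H2 >> `<=` measurable ->
  <<s H3 >> `<=` measurable -> <<s H >> `<=` measurable -> H4 `<=` H ->
  independent4 <<s H1 >> <<s H2 >> <<s H3 >> <<s H >> ->
  <<s H >> E -> <<s H4 >> `<=` independent_of P E ->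
  <<s H1 `|` H2 `|` H3 `|` H4 >> `<=` independent_of P E.
Proof.
move=> m1 m2 m3 m4 H4H ind HE H4E.
have sT G : <<s G >> [set: T] by exact: (@measurableT _ (g_sigma_algebraType G)).
have sI G A B : <<s G >> A -> <<s G >> B -> <<s G >> (A `&` B).
  exact: (@measurableI _ (g_sigma_algebraType G)).
have H4H' : <<s H4 >> `<=` <<s H >> by exact: sub_sigma_algebra2.
pose C := [set A | exists A1 A2 A3 A4, [/\ <<s H1 >> A1, <<s H2 >> A2,
  <<s H3 >> A3, <<s H4 >> A4 & A = A1 `&` A2 `&` A3 `&` A4]].
have CI : setI_closed C.
  move=> _ _ [A1 [A2 [A3 [A4 [? ? ? ? ->]]]]] [B1 [B2 [B3 [B4 [? ? ? ? ->]]]]].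
  exists (A1 `&` B1), (A2 `&` B2), (A3 `&` B3), (A4 `&` B4).
  split; try exact: sI.
  by apply/seteqP; split => w /=; tauto.
suff CE : C `<=` independent_of P E.
  apply: subset_trans (independent_of_generated CI (m4 _ HE) CE).
  apply: sub_sigma_algebra2 => A [[[]|]|] HA.
  - exists A, setT, setT, setT; split => //; last by rewrite !setIT.
    exact: sub_sigma_algebra.
  - exists setT, A, setT, setT; split => //; last by rewrite !setIT setTI.
    exact: sub_sigma_algebra.
  - exists setT, setT, A, setT; split => //; last by rewrite !setIT !setTI.
    exact: sub_sigma_algebra.
  - exists setT, setT, setT, A; split => //; last by rewrite !setTI.
    exact: sub_sigma_algebra.
move=> _ [A1 [A2 [A3 [A4 [G1 G2 G3 G4 ->]]]]]; split.
  apply: measurableI; last exact: m4 (H4H' _ G4).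
  by apply: measurableI; [apply: measurableI; [exact: m1|exact: m2]|exact: m3].
have e1 := ind _ _ _ _ G1 G2 G3 (H4H' _ G4).
have e2 := ind _ _ _ _ G1 G2 G3 (sI _ _ _ (H4H' _ G4) HE).
have [_ e3] := H4E _ G4.
have -> : A1 `&` A2 `&` A3 `&` A4 `&` E = A1 `&` A2 `&` A3 `&` (A4 `&` E).
  by rewrite [RHS]setIA.
apply: (etrans e2); apply: (etrans (congr1 _ e3)).
by rewrite muleA; congr (_ * _)%E; exact/esym.
Qed.

End FourSigmaAlgebras.

Lemma g_sigma_algebra_ae_eq d (T : measurableType d) (R : realType) (P : probability T R)
    (G : set (set T)) (A A' : set T) : P.-negligible `<=` <<s G >> ->
  <<s G >> A -> (\forall w \ae P, A w <-> A' w) -> <<s G >> A'.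
Proof.
move=> GN GA AA'; pose N := ~` [set w | A w <-> A' w].
have -> : A' = (A `\` N) `|` (A' `&` N).
  apply/seteqP; split => w /=; rewrite /N /=; have := EM (A w <-> A' w); tauto.
suff : measurable ((A `\` N) `|` (A' `&` N) : set (g_sigma_algebraType G)) by [].
apply: measurableU; first by apply: measurableD => //; exact: GN.
by apply: GN; apply: negligibleS AA' => w [].
Qed.

Section TimeChangedSum.
Context d (T : measurableType d) (R : realType) (P : probability T R).
Variables (B1 B2 X W r1 r2 : R -> T -> R) (c0 c1 c2 c3 eps : R).
Hypotheses (eps0 : 0 < eps) (c3_neq0 : c3 != 0).
Hypotheses (mB1 : is_process B1) (mB2 : is_process B2) (mX : is_process X).
Hypothesis W_BM : brownian_motion P W.
Hypothesis ind : independent4 P <<s history B1 >> <<s history B2 >>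
  <<s history X >> <<s history W >>.
Hypotheses (cB1 : \forall w \ae P, cadlag (B1 ^~ w))
  (cB2 : \forall w \ae P, cadlag (B2 ^~ w))
  (cX : \forall w \ae P, cadlag (X ^~ w)).
Hypotheses
  (cr1 : \forall w \ae P, {within `[0, +oo[, continuous (r1 ^~ w)})
  (cr2 : \forall w \ae P, {within `[0, +oo[, continuous (r2 ^~ w)})
  (r1_ge : \forall w \ae P, forall t, 0 <= t -> eps <= r1 t w)
  (r2_ge : \forall w \ae P, forall t, 0 <= t -> 0 <= r2 t w).
Hypotheses
  (wr1 : forall t, 0 <= t ->
    wrt <<s (history B1 `|` history B2) `|` P.-negligible >> (r1 t))
  (wr2 : forall t, 0 <= t ->
    wrt <<s (history B1 `|` history B2) `|` P.-negligible >> (r2 t)).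

Let T1 := clock r1.
Let T2 := clock r2.
Let Y t w := c0 * T1 t w + c1 * B1 (T1 t w) w + c2 * B2 (T1 t w) w
  + c3 * W (T1 t w) w + X (T2 t w) w.
(** Full paths of [B1], [B2], [X], which up to null sets determine the clocks, but [W] only up to
    [a]: excursions of [W] after [a] remain independent of it. *)
Let F0 a := history B1 `|` history B2 `|` history X `|` past W a.
Let F a := F0 a `|` P.-negligible.
Let G t := past Y t `|` past T1 t `|` past T2 t.

(** Gathers the almost sure path properties, so that the later arguments are pathwise. *)
Let good : set T := [set w |
  [/\ cadlag (B1 ^~ w), cadlag (B2 ^~ w), cadlag (X ^~ w) & cadlag (W ^~ w)] /\
  [/\ right_cont (T1 ^~ w), right_cont (T2 ^~ w),
   (forall s t, 0 <= s -> s <= t -> eps * (t - s) <= T1 t w - T1 s w),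
   (forall s t, 0 <= s -> s <= t -> T2 s w <= T2 t w) &
   T1 0 w = 0 /\ T2 0 w = 0]].

Let good_ae : \forall w \ae P, good w.
Proof.
have [_ _ cW _ _] := W_BM.
near=> w.
have k1 : {within `[0, +oo[, continuous (r1 ^~ w)} by near: w.
have k2 : {within `[0, +oo[, continuous (r2 ^~ w)} by near: w.
have g1 : forall t, 0 <= t -> eps <= r1 t w by near: w.
have g2 : forall t, 0 <= t -> 0 <= r2 t w by near: w.
split.
  by split; [near: w|near: w|near: w|apply: continuous_cadlag; near: w].
split.
- exact: Rintegral_right_cont k1.
- exact: Rintegral_right_cont k2.
- by move=> s t s0 st; exact: (Rintegral_increment_ge k1 g1).
- move=> s t s0 st; rewrite -subr_ge0 -(mul0r (t - s)).
  exact: (Rintegral_increment_ge k2 g2).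
- by split; exact: Rintegral_at0.
Unshelve. all: by end_near. Qed.

Let T1_homo w s t : good w -> 0 <= s -> s <= t -> T1 s w <= T1 t w.
Proof.
move=> [_ [_ _ inc _ _]] s0 st; rewrite -subr_ge0.
by apply: le_trans (inc _ _ s0 st); rewrite mulr_ge0 ?subr_ge0// ltW.
Qed.

Let T1_ge0 w t : good w -> 0 <= t -> 0 <= T1 t w.
Proof. by move=> gw t0; have [_ [_ _ _ _ [<- _]]] := gw; exact: T1_homo. Qed.

Let T2_ge0 w t : good w -> 0 <= t -> 0 <= T2 t w.
Proof. by move=> gw t0; have [_ [_ _ _ inc [_ <-]]] := gw; exact: inc. Qed.

Let FN a : P.-negligible `<=` <<s F a >>.
Proof. by move=> A NA; apply: sub_sigma_algebra; right. Qed.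

Let wrt_history_F (Z : R -> T -> R) a t : history Z `<=` F0 a -> 0 <= t -> wrt <<s F a >> (Z t).
Proof.
move=> ZF t0; apply: (@wrt_sub _ _ _ (past Z t)); last first.
  by apply: wrt_past; rewrite t0 lexx.
apply: sub_sigma_algebra2 => A pA; left; apply: ZF.
exact: past_history pA.
Qed.

Let wB1 a t : 0 <= t -> wrt <<s F a >> (B1 t).
Proof. by apply: wrt_history_F => A; left; left; left. Qed.

Let wB2 a t : 0 <= t -> wrt <<s F a >> (B2 t).
Proof. by apply: wrt_history_F => A; left; left; right. Qed.

Let wX a t : 0 <= t -> wrt <<s F a >> (X t).
Proof. by apply: wrt_history_F => A; left; right. Qed.

(** Freezing [W] at [a] makes it measurable for [F a] at all times, while agreeing with [W] as long
    as the clock is at most [a]. *)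
Let Wstop a t w := W (Num.min t a) w.

Let wW a t : 0 <= a -> 0 <= t -> wrt <<s F a >> (Wstop a t).
Proof.
move=> a0 t0; apply: (@wrt_sub _ _ _ (past W a)); last first.
  by apply: wrt_past; rewrite le_min t0 a0 ge_min lexx orbT.
by apply: sub_sigma_algebra2 => A; left; right.
Qed.

Let sub_rates a :
  <<s (history B1 `|` history B2) `|` P.-negligible >> `<=` <<s F a >>.
Proof.
apply: sub_sigma_algebra2 => A [HA|]; last by right.
by left; left; left.
Qed.

Let wT1 a t : wrt <<s F a >> (T1 t).
Proof.
apply: (@wrt_clock _ _ _ P); first exact: FN.
- by move=> s s0; apply: wrt_sub (wr1 s0); exact: sub_rates.
- by apply: filterS cr1 => w /continuous_cadlag[].
- by apply: filterS r1_ge => w h s s0; rewrite (le_trans (ltW eps0))// h.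
Qed.

Let wT2 a t : wrt <<s F a >> (T2 t).
Proof.
apply: (@wrt_clock _ _ _ P); first exact: FN.
- by move=> s s0; apply: wrt_sub (wr2 s0); exact: sub_rates.
- by apply: filterS cr2 => w /continuous_cadlag[].
- exact: r2_ge.
Qed.

Let Wstop_right_cont a w : 0 <= a -> good w -> right_cont (Wstop a ^~ w).
Proof.
move=> a0 [[_ _ _ [rW _]] _].
apply: (@right_cont_comp _ (W ^~ w) (fun s => Num.min s a)) => //.
- exact: right_cont_minl.
- by rewrite le_min lexx.
- by move=> r s _ rs; rewrite le_min !ge_min rs lexx orbT.
Qed.

Let Ystop a t w := c0 * T1 t w + c1 * B1 (T1 t w) w + c2 * B2 (T1 t w) w
  + c3 * Wstop a (T1 t w) w + X (T2 t w) w.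

Let wYstop a t : 0 <= a -> 0 <= t -> wrt <<s F a >> (Ystop a t).
Proof.
move=> a0 t0.
have T10 : \forall w \ae P, 0 <= T1 t w.
  by apply: filterS good_ae => w gw; exact: T1_ge0.
have T20 : \forall w \ae P, 0 <= T2 t w.
  by apply: filterS good_ae => w gw; exact: T2_ge0.
have cmp (Z : R -> T -> R) th : (forall t, 0 <= t -> wrt <<s F a >> (Z t)) ->
    (\forall w \ae P, right_cont (Z ^~ w)) -> wrt <<s F a >> th ->
    (\forall w \ae P, 0 <= th w) ->
    measurable_fun setT ((fun w => Z (th w) w) : g_sigma_algebraType (F a) -> R).
  by move=> ? ? ? ?; apply: (wrtP _ _).1; apply: (@wrt_compose _ _ _ P) => //; exact: FN.
apply: (wrtP _ _).2; apply: measurable_funD; last first.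
  by apply: cmp => //; [exact: wX|apply: filterS cX => w []].
apply: measurable_funD; last first.
  apply: measurable_funM => //; apply: cmp => //; first by move=> s; exact: wW.
  by apply: filterS good_ae => w; exact: Wstop_right_cont.
apply: measurable_funD; last first.
  by apply: measurable_funM => //; apply: cmp => //; [exact: wB2|apply: filterS cB2 => w []].
apply: measurable_funD; last first.
  by apply: measurable_funM => //; apply: cmp => //; [exact: wB1|apply: filterS cB1 => w []].
by apply: measurable_funM => //; apply: (wrtP _ _).1; exact: wT1.
Qed.

Let F_setI a A B : <<s F a >> A -> <<s F a >> B -> <<s F a >> (A `&` B).
Proof. exact: (@measurableI _ (g_sigma_algebraType (F a))). Qed.

Let le_T1_F a u y : <<s F a >> [set w | T1 u w <= y].
Proof.
have -> : [set w | T1 u w <= y] = T1 u @^-1` `]-oo, y].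
  by apply/seteqP; split => w /=; rewrite in_itv.
exact: wT1.
Qed.

Let le_T2_F a u y : <<s F a >> [set w | T2 u w <= y].
Proof.
have -> : [set w | T2 u w <= y] = T2 u @^-1` `]-oo, y].
  by apply/seteqP; split => w /=; rewrite in_itv.
exact: wT2.
Qed.

Let ge_T1_F a u y : <<s F a >> [set w | y <= T1 u w].
Proof.
have -> : [set w | y <= T1 u w] = T1 u @^-1` `[y, +oo[.
  by apply/seteqP; split => w /=; rewrite in_itv/= andbT.
exact: wT1.
Qed.

(* Before the clock reaches [a], only the path of [W] up to [a] matters. *)
Lemma sub_past_clock a u A : 0 <= a -> <<s G u `|` P.-negligible >> A ->
  <<s F a >> (A `&` [set w | T1 u w <= a]).
Proof.
move=> a0; pose Q := [set w | T1 u w <= a].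
(* Sets with trace on [Q] in [<<s F a >>] form a sigma-algebra, so generators suffice; on [Q] one
   has T1 s <= a for s <= u, whence [Y] and [Ystop a] coincide there. *)
suff : <<s G u `|` P.-negligible >> `<=` [set A | <<s F a >> (A `&` Q)] by apply.
apply: smallest_sub.
  split => [|B FB|B FB] /=.
  - by rewrite set0I; exact: sigma_algebra0.
  - have -> : (setT `\` B) `&` Q = Q `\` (B `&` Q).
      by apply/seteqP; split => w /=; tauto.
    by apply: (sigma_algebra_setD (smallest_sigma_algebra _ _)) => //; exact: le_T1_F.
  - by rewrite setI_bigcupl; exact: sigma_algebra_bigcup.
move=> B [[[]|]|NB] /=; last by (apply: F_setI; last exact: le_T1_F); exact: FN.
- move=> [s [D [/andP[s0 su] mD ->]]].
  apply: (@g_sigma_algebra_ae_eq _ _ _ P _ (Ystop a s @^-1` D `&` Q)); first exact: FN.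
    by (apply: F_setI; last exact: le_T1_F); exact: wYstop.
  apply: filterS good_ae => w gw /=.
  suff Qw : Q w -> Ystop a s w = Y s w.
    by split => -[h Qw']; move: h; rewrite Qw.
  move=> ua; rewrite /Ystop /Y /Wstop min_l//.
  by apply: le_trans ua; exact: T1_homo.
- move=> [s [D [/andP[s0 su] mD ->]]].
  by (apply: F_setI; last exact: le_T1_F); exact: wT1.
- move=> [s [D [/andP[s0 su] mD ->]]].
  by (apply: F_setI; last exact: le_T1_F); exact: wT2.
Qed.

Lemma time_changed_right_cont : \forall w \ae P, right_cont (Y ^~ w).
Proof.
apply: filterS good_ae => w gw.
have [[[rB1 _] [rB2 _] [rX _] [rW _]] [rT1 rT2 _ inc2 [T10 T20]]] := gw.
have cmp1 x : right_cont x -> right_cont (fun t => x (T1 t w)).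
  move=> rx; apply: (@right_cont_comp _ x (T1 ^~ w)) => //; first by rewrite T10.
  by move=> s t; exact: T1_homo.
apply: right_contD; last first.
  by apply: (@right_cont_comp _ (X ^~ w) (T2 ^~ w)) => //; rewrite T20.
apply: right_contD; last exact: right_contZ (cmp1 _ rW).
apply: right_contD; last exact: right_contZ (cmp1 _ rB2).
apply: right_contD; last exact: right_contZ (cmp1 _ rB1).
exact: right_contZ.
Qed.

Let grid_F a (Z : R -> T -> R) M N : (forall t, 0 <= t -> wrt <<s F a >> (Z t)) ->
  <<s F a >> (\bigcap_n grid_bounded Z M N n).
Proof.
move=> wZ; apply: (@bigcapT_measurable _ (g_sigma_algebraType (F a))) => n.
apply: grid_bounded_measurable => i _; apply: wZ.
by rewrite divr_ge0// exprn_ge0.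
Qed.

(** Countably many pieces cover [A] up to a null set: [l] locates the clock at [u], [m] bounds both
    clocks at [C], [M] bounds the paths. On each piece an independent excursion of [W] forces a
    crossing. *)
Lemma time_changed_crossing : conditional_crossing P G Y.
Proof.
move=> b u v C A b0 u0 uv GA NA.
(* If C < v the crossing condition is vacuous and [A] itself is negligible. *)
have [Cv|vC] := ltP C v.
  apply: negligibleS NA => w Aw; split => // r t _ /andP[vt tC].
  by have := le_lt_trans (le_trans vt tC) Cv; rewrite ltxx.
(* From l eta <= T1 u and growth at least 2 eta between [u] and [v], the clock at [v] is at least (l
   + 2) eta = a l + eta, where the excursion has begun. *)
pose eta := eps * (v - u) / 2.
have eta0 : 0 < eta by rewrite divr_gt0// mulr_gt0// subr_gt0.
have etaE : eps * (v - u) = eta + eta by rewrite /eta; field.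
have v0 : 0 <= v by rewrite (le_trans u0)// ltW.
have C0 : 0 <= C by exact: le_trans vC.
pose a l : R := l.+1%:R * eta.
have a0 l : 0 <= a l by rewrite mulr_ge0// ltW.
pose bounds l m M := [set w | l%:R * eta <= T1 u w] `&`
  [set w | T1 C w <= m%:R] `&` [set w | T2 C w <= m%:R] `&`
  (\bigcap_n grid_bounded B1 M%:R m.+1 n) `&`
  (\bigcap_n grid_bounded B2 M%:R m.+1 n) `&`
  (\bigcap_n grid_bounded X M%:R m.+1 n) `&`
  (\bigcap_n grid_bounded (Wstop (a l)) M%:R m.+1 n).
pose piece l m M := A `&` [set w | T1 u w <= a l] `&` bounds l m M.
have Npiece l m M : P.-negligible (piece l m M).
  (* Bounds, term by term, the part of b (Y_t - Y_r) other than the increment of [W] after [a l];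
     the factor |1| belongs to [X]. *)
  pose K := `|b| * (`|c0| * (m%:R + m%:R) + `|c1| * (M%:R + M%:R) +
    `|c2| * (M%:R + M%:R) + `|c3| * (M%:R + M%:R) + `|1| * (M%:R + M%:R)).
  have bc3 : b * c3 != 0 by rewrite mulf_neq0.
  have [E [HE PE iE lowE]] :=
    brownian_excursion K m%:R W_BM (a0 l) eta0 bc3.
  have mW : is_process W by case: W_BM.
  have HW := history_measurable mW.
  apply: (negligible_of_independent (HW _ HE) PE (G := F0 (a l))).
  - apply: (independent_of_join4 _ _ _ HW _ ind HE iE);
      [exact: history_measurable..|].
    exact: past_history.
  - apply: F_setI; first exact: sub_past_clock.
    apply: F_setI; last by apply: grid_F => t; exact: wW.
    apply: F_setI; last by apply: grid_F => t; exact: wX.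
    apply: F_setI; last by apply: grid_F => t; exact: wB2.
    apply: F_setI; last by apply: grid_F => t; exact: wB1.
    apply: F_setI; last exact: le_T2_F.
    by apply: F_setI; [exact: ge_T1_F|exact: le_T1_F].
  apply: negligibleS (negligibleU NA (negligibleU good_ae lowE)) => w.
  move=> [[[Aw ua] [[[[[[lu Tm1] Tm2] g1] g2] gX] gW]] Ew].
  have [gw|] := pselect (good w); last by right; left.
  have [low|nlow] := pselect (E w -> forall r, a l + eta <= r <= m%:R ->
    b * c3 * (W r w - W (a l) w) < - K); last by right; right.
  left; split => // r t /andP[r0 ru] /andP[vt tC].
  have {}low := low Ew.
  have {}lu : l%:R * eta <= T1 u w by [].
  have [[[rB1 _] [rB2 _] [rX _] _] [_ _ inc1 inc2 _]] := gw.
  have t0 : 0 <= t by exact: le_trans vt.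
  have mS (x : R) : x <= m%:R -> x + 1 <= m.+1%:R by rewrite -natr1 lerD2r.
  have T1m s : 0 <= s -> s <= C -> T1 s w <= m%:R.
    by move=> s0 sC; apply: le_trans Tm1; exact: T1_homo.
  have T2m s : 0 <= s -> s <= C -> T2 s w <= m%:R.
    by move=> s0 sC; apply: le_trans Tm2; exact: inc2.
  have rC : r <= C by rewrite (le_trans ru)// (le_trans (ltW uv)).
  have bB1 s : 0 <= s -> s <= C -> `|B1 (T1 s w) w| <= M%:R.
    by move=> s0 sC; apply: (grid_bounded_path rB1 g1); [exact: T1_ge0|exact/mS/T1m].
  have bB2 s : 0 <= s -> s <= C -> `|B2 (T1 s w) w| <= M%:R.
    by move=> s0 sC; apply: (grid_bounded_path rB2 g2); [exact: T1_ge0|exact/mS/T1m].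
  have bX s : 0 <= s -> s <= C -> `|X (T2 s w) w| <= M%:R.
    by move=> s0 sC; apply: (grid_bounded_path rX gX); [exact: T2_ge0|exact/mS/T2m].
  have bT1 s : 0 <= s -> s <= C -> `|T1 s w| <= m%:R.
    by move=> s0 sC; rewrite ger0_norm; [exact: T1m|exact: T1_ge0].
  have aeta : a l + eta <= T1 t w.
    have := inc1 _ _ u0 (ltW uv); rewrite etaE.
    have := T1_homo gw v0 vt.
    by rewrite /a -natr1 mulrDl mul1r => ? ?; lra.
  (* Keeps [0, a l] within the range on which the grid bound for [Wstop] applies. *)
  have am : a l <= m%:R.
    by have := T1m _ t0 tC; lra.
  have bW x : 0 <= x -> x <= a l -> `|W x w| <= M%:R.
    move=> x0 xa; have := grid_bounded_path (Wstop_right_cont (a0 l) gw) gW x0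
      (mS _ (le_trans xa am)).
    by rewrite /Wstop min_l.
  have Tra : T1 r w <= a l by apply: le_trans ua; exact: T1_homo.
  have low1 : b * c3 * (W (T1 t w) w - W (a l) w) < - K.
    by apply: low; rewrite aeta T1m.
  have diff (c x y k : R) : `|x| <= k -> `|y| <= k ->
      `|c * (x - y)| <= `|c| * (k + k).
    move=> xk yk; rewrite normrM ler_wpM2l//.
    by apply: le_trans (ler_normB _ _) _; exact: lerD.
  pose rest := c0 * (T1 t w - T1 r w) + c1 * (B1 (T1 t w) w - B1 (T1 r w) w)
    + c2 * (B2 (T1 t w) w - B2 (T1 r w) w) + c3 * (W (a l) w - W (T1 r w) w)
    + 1 * (X (T2 t w) w - X (T2 r w) w).
  have restK : b * rest <= K.
    apply: le_trans (ler_norm _) _; rewrite normrM ler_wpM2l//.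
    apply: le_trans (ler_normD _ _) _; apply: lerD; last first.
      by apply: diff; exact: bX.
    apply: le_trans (ler_normD _ _) _; apply: lerD; last first.
      by apply: diff; apply: bW => //; exact: T1_ge0.
    apply: le_trans (ler_normD _ _) _; apply: lerD; last first.
      by apply: diff; exact: bB2.
    apply: le_trans (ler_normD _ _) _; apply: lerD; last first.
      by apply: diff; exact: bB1.
    by apply: diff; exact: bT1.
  have -> : b * (Y t w - Y r w) =
      b * c3 * (W (T1 t w) w - W (a l) w) + b * rest.
    by rewrite /Y /rest; ring.
  by lra.
have NB : P.-negligible (\bigcup_l \bigcup_m \bigcup_M piece l m M).
  by do 3 apply: negligible_bigcup => ?.
apply: negligibleS (negligibleU NB good_ae) => w Aw.
have [gw|] := pselect (good w); last by right.
left; have [[cB1w cB2w cXw cWw] _] := gw.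
(* Choice of the piece containing a given good path. *)
pose l := Num.truncn (T1 u w / eta).
pose m := (Num.truncn (Num.max (T1 C w) (T2 C w))).+1.
have /andP[lu ul] : l%:R <= T1 u w / eta < l.+1%:R.
  by apply: truncn_itv; rewrite divr_ge0 ?(ltW eta0)//; exact: T1_ge0.
have mT : Num.max (T1 C w) (T2 C w) <= m%:R by exact/ltW/truncnS_gt.
move: mT; rewrite ge_max => /andP[mT1 mT2].
have [M1 HM1] := cadlag_bounded m.+1%:R cB1w.
have [M2 HM2] := cadlag_bounded m.+1%:R cB2w.
have [M3 HM3] := cadlag_bounded m.+1%:R cXw.
have [M4 HM4] := cadlag_bounded m.+1%:R cWw.
pose M := (Num.truncn (Num.max (Num.max M1 M2) (Num.max M3 M4))).+1.
have : Num.max (Num.max M1 M2) (Num.max M3 M4) <= M%:R by exact/ltW/truncnS_gt.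
rewrite !ge_max => /andP[/andP[M1M M2M] /andP[M3M M4M]].
exists l => //; exists m => //; exists M => //.
split.
  by split => //=; rewrite /a -ler_pdivrMr// ltW.
split; last first.
  apply: bounded_grid => t /andP[t0 tm]; apply: le_trans M4M; apply: HM4.
  by rewrite le_min t0 a0 ge_min tm.
split; last by apply: bounded_grid => t tm; apply: le_trans M3M; exact: HM3.
split; last by apply: bounded_grid => t tm; apply: le_trans M2M; exact: HM2.
split; last by apply: bounded_grid => t tm; apply: le_trans M1M; exact: HM1.
by split => //; split => //=; rewrite -ler_pdivlMr.
Qed.

End TimeChangedSum.

(** * Passage to the exponential and conclusion *)

Section Exponential.
Context d (T : measurableType d) (R : realType) (P : probability T R).
Variables (G : R -> set (set T)) (Y : R -> T -> R).

(** A strictly increasing function preserves the sign of increments, hence crossings. *)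
Lemma conditional_crossing_expR : conditional_crossing P G Y ->
  conditional_crossing P G (fun t w => expR (Y t w)).
Proof.
move=> cY b u v C A b0 u0 uv GA NA; apply: (cY b u v C A) => //.
apply: negligibleS NA => w [Aw cw]; split => // r t ru vt.
have := cw r t ru vt.
have [b_lt0|b_gt0|b00] := ltgtP b 0; last by rewrite b00 eqxx in b0.
  by rewrite !nmulr_rlt0// !subr_gt0 ltr_expR.
by rewrite !pmulr_rlt0// !subr_lt0 ltr_expR.
Qed.

Lemma right_cont_expR :
  (\forall w \ae P, right_cont (Y ^~ w)) ->
  \forall w \ae P, right_cont (fun t => expR (Y t w)).
Proof.
apply: filterS => w rY t t0.
by apply: (cvg_comp _ expR) (rY t t0) _; exact: continuous_expR.
Qed.

End Exponential.

Lemma wrt_adapted_augmented d (T : measurableType d) (R : realType)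
    (P : probability T R) (B1 B2 v : R -> T -> R) t :
  adapted (augmented P (fun t => past B1 t `|` past B2 t)) v -> 0 <= t ->
  wrt <<s (history B1 `|` history B2) `|` P.-negligible >> (v t).
Proof.
move=> av t0 B mB; have := av t t0 B mB (t + 1); rewrite ltrDl ltr01 => /(_ isT).
apply: sub_sigma_algebra2 => A [[pA|pA]|NA]; last by right.
  by left; left; apply: past_history pA; rewrite addr_ge0.
by left; right; apply: past_history pA; rewrite addr_ge0.
Qed.


Theorem theorem4p8 (R : realType) (d : measure_display) (T : measurableType d)
  (P : probability T R)
  (Bc Bj Wc Wj J Xj vc vj : R -> T -> R)
  (ac1 ac2 ac3 ac4 aj1 aj2 muc muj sigmac sigmaj rho eps vc0 vj0 : R)
  (rho_itv : -1 <= rho <= 1) (ac4_neq0 : ac4 != 0)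
  (eps_itv : 0 < eps < 1)
  (Bc_BM : brownian_motion P Bc) (Bj_BM : brownian_motion P Bj)
  (Wc_BM : brownian_motion P Wc) (Wj_BM : brownian_motion P Wj)
  (BM_indep : mutually_independent P (fun i : 'I_4 =>
     <<s history (tnth [tuple Bc; Bj; Wc; Wj] i) >>))
  (J_levy : levy_process P J) (J_jump : nondecreasing_pure_jump P J)
  (Xj_levy : levy_process P Xj) (Xj_jump : pure_jump P Xj)
  (Xj_def : (\forall w \ae P, forall t, 0 <= t ->
     Xj t w = aj1 * J t w + aj2 * Wj (J t w) w))
  (Xj_indep : independent P <<s history Xj >>
     <<s history Bc `|` history Bj `|` history Wc >>)
  (vc_ge0 : (\forall w \ae P, forall t, 0 <= t -> 0 <= vc t w))
  (vj_ge0 : (\forall w \ae P, forall t, 0 <= t -> 0 <= vj t w))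
  (vc_sde : strong_solution P Bc Bj
     (fun x => muc * (1 - eps - x))
     (fun x => sigmac * Num.sqrt (x * (1 - rho ^+ 2)))
     (fun x => rho * sigmac * Num.sqrt x) vc0 vc)
  (vj_sde : strong_solution P Bc Bj
     (fun x => muj * (1 - x))
     (fun=> 0)
     (fun x => sigmaj * Num.sqrt x) vj0 vj) :
  let Tc := clock (fun s w => vc s w + eps) in
  let Tj := clock vj in
  let Xc t w := ac1 * t + ac2 * Bc t w + ac3 * Bj t w + ac4 * Wc t w in
  let Y t w := Xc (Tc t w) w + Xj (Tj t w) w in
  let F := augmented P (fun t => past Y t `|` past Tc t `|` past Tj t) in
  no_arbitrage P F (cheridito P F) (fun t w => expR (Y t w)).
Proof.
move=> Tc Tj Xc Y F.
have [eps0 _] := andP eps_itv.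
have [mBc _ cBc _ _] := Bc_BM; have [mBj _ cBj _ _] := Bj_BM.
have [mXj _ cXj _ _] := Xj_levy.
have [avc cvc _] := vc_sde; have [avj cvj _] := vj_sde.
have ind := independent4_of_mutual BM_indep Xj_indep.
have cad B : continuous_paths P B -> \forall w \ae P, cadlag (B ^~ w).
  by apply: filterS => w; exact: continuous_cadlag.
have crc : \forall w \ae P,
    {within `[0, +oo[, continuous (fun s => vc s w + eps)}.
  by apply: filterS cvc => w cw s; apply: cvgD; [exact: cw|exact: cvg_cst].
(* The shift by [eps] is what bounds the growth of the first clock from below. *)
have rc_ge : \forall w \ae P, forall t, 0 <= t -> eps <= vc t w + eps.
  by apply: filterS vc_ge0 => w vw t t0; rewrite lerDr vw.
have wvj t : 0 <= t ->
    wrt <<s (history Bc `|` history Bj) `|` P.-negligible >> (vj t).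
  exact: wrt_adapted_augmented avj.
have wrc t : 0 <= t ->
    wrt <<s (history Bc `|` history Bj) `|` P.-negligible >>
      (fun w => vc t w + eps).
  move=> t0; apply: (wrtP _ _).2; apply: measurable_funD => //.
  by apply: (wrtP _ _).1; exact: wrt_adapted_augmented avc t0.
apply: no_arbitrage_of_crossing.
- move=> t u tu B mB; apply: sub_sigma_algebra; left; left.
  exists t, (expR @^-1` B); split => //.
  by rewrite -[_ @^-1` _]setTI; exact: measurable_expR.
- apply: right_cont_expR.
  exact: (time_changed_right_cont ac1 ac2 ac3 ac4 eps0 Wc_BM (cad _ cBc)
    (cad _ cBj) cXj crc cvj rc_ge vj_ge0).
- apply: conditional_crossing_expR.
  exact: (time_changed_crossing (c0 := ac1) (c1 := ac2) (c2 := ac3) eps0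
    ac4_neq0 mBc mBj mXj Wc_BM ind
    (cad _ cBc) (cad _ cBj) cXj crc cvj rc_ge vj_ge0 wrc wvj).
Qed.
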